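(* Let $k$ be an algebraically closed field of characteristic $0$ and let $R$ be a commutative complete Gorenstein local $k$-algebra with residue field $k$ which is of finite representation type. Suppose that $\underline{U}\cong\underline{U}[-1]$ in $\underline{\mathrm{CM}}(R)$ for each indecomposable Cohen-Macaulay $R$-module $U$. Let $M$ and $N$ be Cohen-Macaulay $R$-modules. Then $\dim_k \underline{\mathrm{Hom}}_R(X,M)=\dim_k\underline{\mathrm{Hom}}_R(X,N)$ for each object $\underline{X}$ of $\underline{\mathrm{CM}}(R)$ if and only if $\underline{M}\cong\underline{N}$ in $\underline{\mathrm{CM}}(R)$. In particular, the stable hom relation $\leq_{\underline{hom}}$ is a partial order on (isomorphism classes of objects of) $\underline{\mathrm{CM}}(R)$.
   Context: Local rings are Noetherian. A finitely generated $R$-module $M$ is called Cohen-Macaulay if $\mathrm{Ext}^i_R(M,R)=0$ for all $i>0$; $\mathrm{CM}(R)$ is the category of these modules with all $R$-homomorphisms. The stable category $\underline{\mathrm{CM}}(R)$ has the same objects as $\mathrm{CM}(R)$ and morphisms $\underline{\mathrm{Hom}}_R(M,N)=\mathrm{Hom}_R(M,N)/P(M,N)$, where $P(M,N)$ is the set of homomorphisms $M\to N$ factoring through a free $R$-module. $\underline{M}$ denotes $M$ viewed as an object of $\underline{\mathrm{CM}}(R)$. The syzygy functor $\Omega$ (taking $M$ to the kernel of a surjection from a finitely generated free module onto $M$) is an auto-equivalence of $\underline{\mathrm{CM}}(R)$, and $\underline{\mathrm{CM}}(R)$ is triangulated with shift $[1]$ inverse to $\Omega$, so $\underline{M}[-1]\cong\underline{\Omega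 M}$. $R$ is of finite representation type if there are only finitely many isomorphism classes of indecomposable Cohen-Macaulay $R$-modules. In this case each $\underline{\mathrm{Hom}}_R(M,N)$ is finite dimensional over $k$. Stable hom relation: $\underline{M}\leq_{\underline{hom}}\underline{N}$ means $\dim_k\underline{\mathrm{Hom}}_R(X,M)\leq\dim_k\underline{\mathrm{Hom}}_R(X,N)$ for every $\underline{X}\in\underline{\mathrm{CM}}(R)$. *)

(* Defs.v *)
From HB Require Import structures.
From mathcomp Require Import all_boot all_order all_algebra.
From mathcomp Require Import boolp classical_sets.

Set Implicit Arguments.
Unset Strict Implicit.
Unset Printing Implicit Defensive.

Import GRing.Theory.
Local Open Scope ring_scope.
Local Open Scope classical_set_scope.

Section Rings.
Variable R : comNzRingType.

Definition is_ideal (I : set R) : Prop :=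
  [/\ I 0, forall x y, I x -> I y -> I (x + y)
    & forall a x, I x -> I (a * x)].

Definition is_maximal_ideal (I : set R) : Prop :=
  [/\ is_ideal I, ~ I 1
    & forall J : set R, is_ideal J -> I `<=` J -> J = I \/ J 1].

Definition is_local_with (m : set R) : Prop :=
  is_maximal_ideal m /\ forall m' : set R, is_maximal_ideal m' -> m' = m.

Definition is_noetherian : Prop :=
  forall I : set R, is_ideal I ->
    exists (n : nat) (g : 'I_n -> R),
      forall x, I x <-> exists c : 'I_n -> R, x = \sum_i c i * g i.

Definition ideal_mul (I J : set R) : set R :=
  [set x | exists (n : nat) (a b : 'I_n -> R),
      (forall i, I (a i) /\ J (b i)) /\ x = \sum_i a i * b i].

Definition ideal_exp (I : set R) (n : nat) : set R :=
  iter n (ideal_mul I) setT.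

(* Bijectivity of the canonical map from R to the inverse limit of the
   R / I^n: a coherent sequence of classes is represented by u, and
   uniqueness of x is the I-adic separatedness of R. *)
Definition is_adically_complete (I : set R) : Prop :=
  forall u : nat -> R,
    (forall n, ideal_exp I n (u n.+1 - u n)) ->
    exists! x : R, forall n, ideal_exp I n (x - u n).

End Rings.

Section Modules.
Variable R : comNzRingType.
Implicit Types M N E F S : lmodType R.

Definition finitely_generated M : Prop :=
  exists (n : nat) (g : 'I_n -> M),
    forall x, exists c : 'I_n -> R, x = \sum_i c i *: g i.

Definition trivial_module M : Prop := forall x : M, x = 0.

Definition module_iso M N : Prop :=
  exists f : {linear M -> N}, bijective f.

Definition indecomposable M : Prop :=
  ~ trivial_module M /\
  forall A B : lmodType R, module_iso M (A * B)%type ->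
    trivial_module A \/ trivial_module B.

(* Free of arbitrary, possibly infinite, rank. *)
Definition is_basis M (B : set M) : Prop :=
  (forall x, exists (s : seq M) (c : M -> R),
      (forall b, b \in s -> B b) /\ x = \sum_(b <- s) c b *: b) /\
  (forall (s : seq M) (c : M -> R), uniq s -> (forall b, b \in s -> B b) ->
      \sum_(b <- s) c b *: b = 0 -> forall b, b \in s -> c b = 0).

Definition is_free M : Prop := exists B : set M, is_basis B.

Definition injective_module E : Prop :=
  forall (A B : lmodType R) (i : {linear A -> B}) (f : {linear A -> E}),
    injective i -> exists g : {linear B -> E}, forall x, g (i x) = f x.

Definition short_exact M E N (i : {linear M -> E}) (p : {linear E -> N}) : Prop :=
  [/\ injective i, forall y, exists x, p x = y
    & forall x, p x = 0 <-> exists y, x = i y].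

(* There is an exact sequence 0 -> M -> E^0 -> ... -> E^n -> 0 with every
   E^j injective; C is the first cosyzygy. *)
Fixpoint injective_dim_le (n : nat) M : Prop :=
  match n with
  | 0 => injective_module M
  | n'.+1 => exists (E C : lmodType R)
      (i : {linear M -> E}) (p : {linear E -> C}),
      [/\ injective_module E, short_exact i p & injective_dim_le n' C]
  end.

(* ... -> R^(rk 1) -> R^(rk 0) -> M -> 0, exact *)
Record free_resolution M := FreeResolution {
  fr_rank : nat -> nat;
  fr_diff : forall n, {linear 'rV[R]_(fr_rank n.+1) -> 'rV[R]_(fr_rank n)};
  fr_aug : {linear 'rV[R]_(fr_rank 0) -> M};
  fr_aug_surj : forall y, exists x, fr_aug x = y;
  fr_exact0 : forall x, fr_aug x = 0 <-> exists y, x = fr_diff 0 y;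
  fr_exactS : forall n x, fr_diff n x = 0 <-> exists y, x = fr_diff n.+1 y
}.

(* H^i(Hom(P, N)) = 0, for P the complex underlying a resolution of M. *)
Definition Hom_cohomology_eq0 M (P : free_resolution M) (i : nat) N : Prop :=
  forall f : {linear 'rV[R]_(fr_rank P i) -> N},
    (forall x, f (fr_diff P i x) = 0) ->
    match i return {linear 'rV[R]_(fr_rank P i) -> N} -> Prop with
    | 0 => fun f => forall x, f x = 0
    | j.+1 => fun f => exists g : {linear 'rV[R]_(fr_rank P j) -> N},
        forall x, f x = g (fr_diff P j x)
    end f.

(* Meant for M finitely generated over a Noetherian ring, where resolutions by
   free modules of finite rank exist; the choice of one is immaterial. *)
Definition Ext_eq0 (i : nat) M N : Prop :=
  exists P : free_resolution M, Hom_cohomology_eq0 P i N.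

Definition cohen_macaulay M : Prop :=
  finitely_generated M /\ forall i, (0 < i)%N -> Ext_eq0 i M R^o.

(* Objects of CM(R), and hence of the stable category. *)
Record cmType := CMType {
  cm_sort :> lmodType R;
  cmP : cohen_macaulay cm_sort
}.

Definition finite_representation_type : Prop :=
  exists (n : nat) (L : 'I_n -> lmodType R),
    forall U : cmType, indecomposable U -> exists i, module_iso U (L i).

Definition factors_through_free M N (f : M -> N) : Prop :=
  exists (F : lmodType R) (g : {linear M -> F}) (h : {linear F -> N}),
    is_free F /\ forall x, f x = h (g x).

(* Equality of the classes of f and g in Hom(M, N) / P(M, N). *)
Definition stable_eq M N (f g : M -> N) : Prop :=
  factors_through_free (fun x => f x - g x).

Definition stable_iso M N : Prop :=
  exists (f : {linear M -> N}) (g : {linear N -> M}),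
    stable_eq (g \o f) id /\ stable_eq (f \o g) id.

(* S is the kernel of a surjection from a free module of finite rank onto M;
   in the stable category S is then M[-1]. *)
Definition is_syzygy S M : Prop :=
  exists (n : nat) (i : {linear S -> 'rV[R]_n}) (p : {linear 'rV[R]_n -> M}),
    short_exact i p.

Definition stable_iso_shift M : Prop :=
  exists S : lmodType R, is_syzygy S M /\ stable_iso M S.

End Modules.

Definition is_gorenstein (R : comNzRingType) : Prop :=
  is_noetherian R /\ exists n, injective_dim_le n (R^o : lmodType R).

Section StableHom.
Variables (k : fieldType) (R : comAlgType k).

(* The composite k -> R -> R / m is bijective. *)
Definition has_residue_field (m : set R) : Prop :=
  forall x : R, exists! c : k, m (x - c%:A).

(* k acts on homomorphisms through the structure map c |-> c%:A. *)
Definition stable_hom_basis (X M : lmodType R) (n : nat)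
    (e : 'I_n -> {linear X -> M}) : Prop :=
  forall f : {linear X -> M}, exists! c : 'rV[k]_n,
    stable_eq f (fun x => \sum_i ((c 0 i)%:A : R) *: e i x).

Definition has_stable_hom_dim (X M : lmodType R) (n : nat) : Prop :=
  exists e : 'I_n -> {linear X -> M}, stable_hom_basis e.

(* dim_k of Hom(X, M) / P(X, M), where None stands for infinite dimension. *)
Definition stable_hom_dim (X M : lmodType R) : option nat :=
  if pselect (exists n, has_stable_hom_dim X M n) is left h
  then Some (projT1 (cid h)) else None.

Definition dim_le (a b : option nat) : Prop :=
  match a, b with
  | _, None => True
  | None, Some _ => False
  | Some i, Some j => (i <= j)%N
  end.

Definition stable_hom_le (M N : cmType R) : Prop :=
  forall X : cmType R, dim_le (stable_hom_dim X M) (stable_hom_dim X N).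

End StableHom.

(* le induces a partial order on the classes of T modulo eqv. *)
Definition partial_order_mod (T : Type) (eqv le : T -> T -> Prop) : Prop :=
  [/\ [/\ forall x, eqv x x, forall x y, eqv x y -> eqv y x
        & forall x y z, eqv x y -> eqv y z -> eqv x z],
      forall x x' y y', eqv x x' -> eqv y y' -> le x y -> le x' y',
      forall x, le x x,
      forall x y, le x y -> le y x -> eqv x y
    & forall x y z, le x y -> le y z -> le x z].

(* Main.v *)
(* Write h(X, M) for the dimension of the stable Hom space and ~ for equality of
   stable classes.  A map f : Y -> Z gives maps OY -> OZ -> C -> Y -> Z, with OY
   and OZ syzygies of Y and Z, which Hom(-, M) turns into an exact sequence of
   stable Hom spaces, so the ranks of f^* and (Omega f)^* on Hom(-, M) add up to
   h(Y, M) - h(C, M) + h(OZ, M).  Let h(X, M) = h(X, N) for all X and let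
   f : N -> Z be a left add(M)-approximation.  Then f^* is onto on Hom(-, M), and
   so is (Omega f)^* because M is stably isomorphic to its syzygy; by the count of
   ranks both are onto on Hom(-, N).  Hence id_N ~ v f, and N is a stable retract
   of a power of M.  Indecomposable modules have local endomorphism rings, by
   lifting idempotents modulo a characteristic polynomial in the complete ring R,
   so M and N share a stable summand, which cancels; induct on the number of
   indecomposable summands.

   The stable Hom spaces are finite dimensional because each r in the maximal
   ideal acts nilpotently: finite type gives n such that r^n : M -> M stably kills
   ker r^(n+1); then r^n ~ v r^(n+1) for some v, and 1 - r v is invertible. *)
Require Import Defs.
From HB Require Import structures.
From mathcomp Require Import all_boot all_order all_algebra.
From mathcomp Require Import boolp classical_sets functions ring zify.

Set Implicit Arguments.
Unset Strict Implicit.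
Unset Printing Implicit Defensive.

Import GRing.Theory Pdiv.RingMonic.
Local Open Scope ring_scope.

(** * Linear maps, kernels and modules of homomorphisms *)

Section LinearMaps.
Variable R : comNzRingType.
Implicit Types A B E M N P X Y : lmodType R.

(** Stable equality stays a relation between genuine linear maps, and no triangulated structure is
    set up. Exactness of stable Hom comes from short exact sequences whose cokernel D satisfies
    Ext^1(D, R) = 0, since maps into free modules then extend from the kernel. This is why a cocone
    is realised as the kernel of a surjection, made surjective by adding a free cover, and why such
    kernels have to be Cohen-Macaulay.

    Dimensions are optional numbers, and an equality of two infinite ones would carry no
    information; finiteness therefore has to be established before ranks can be compared. It comes
    from chain conditions in the finitely many modules Hom(L, M), with L in the list given by finite
    type.

    The ring End(U) need not be commutative. An endomorphism is lifted to a matrix A on a free cover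
    and studied through polynomials in A, so that Newton iteration takes place in the commutative
    ring R[X]/(chi) with chi the characteristic polynomial of A. *)

Definition mklin X Y (f : X -> Y) (Hf : linear f) : {linear X -> Y} :=
  HB.pack f (GRing.isLinear.Build R X Y *:%R f Hf).

Definition onto (X Y : Type) (f : X -> Y) := forall y, exists x, f x = y.

Lemma ontoX (X Y : Type) (f : X -> Y) : onto f ->
  exists s : Y -> X, forall y, f (s y) = y.
Proof. by move=> H; have [s Hs] := choice H; exists s. Qed.

Lemma factor_onto P B M (q : {linear P -> B}) (w : {linear P -> M}) :
  onto q -> (forall x, q x = 0 -> w x = 0) ->
  exists g : {linear B -> M}, forall x, g (q x) = w x.
Proof.
move=> /ontoX [s sK] H.
have E x y : q x = q y -> w x = w y.
  by move=> e; apply/eqP; rewrite -subr_eq0 -linearB H // linearB e subrr.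
have L : linear (w \o s).
  by move=> a x y /=; rewrite -linearP; apply: E; rewrite linearP !sK.
by exists (mklin L) => x; apply: E; rewrite sK.
Qed.

Lemma linear_bij_inv X Y (f : {linear X -> Y}) : bijective f ->
  exists g : {linear Y -> X}, cancel f g /\ cancel g f.
Proof.
move=> [g fK gK].
have L : linear g by move=> a x y; apply: (can_inj fK); rewrite linearP !gK.
by exists (mklin L).
Qed.

Lemma linear_bijP X Y (f : {linear X -> Y}) :
  (forall x, f x = 0 -> x = 0) -> onto f -> bijective f.
Proof.
move=> Hi /ontoX [s sK]; exists s => // x.
by apply/eqP; rewrite -subr_eq0; apply/eqP/Hi; rewrite linearB sK subrr.
Qed.

Section Injections.
Variables X Y : lmodType R.

Fact inlp_linear : linear (fun x : X => (x, 0 : Y)).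
Proof. by move=> a x y; apply: injective_projections; rewrite //= scaler0 addr0. Qed.
Definition inlp : {linear X -> (X * Y)%type} := mklin inlp_linear.

Fact inrp_linear : linear (fun y : Y => (0 : X, y)).
Proof. by move=> a x y; apply: injective_projections; rewrite //= scaler0 addr0. Qed.
Definition inrp : {linear Y -> (X * Y)%type} := mklin inrp_linear.

Lemma prod_split (z : X * Y) : z = inlp z.1 + inrp z.2.
Proof. by case: z => x y; apply: injective_projections; rewrite /= ?addr0 ?add0r. Qed.

End Injections.

Section Kernel.
Variables (X Y : lmodType R) (f : {linear X -> Y}).

Definition kerpred : {pred X} := [pred x | f x == 0].

Fact kerpred_closed : submod_closed kerpred.
Proof.
split=> [|a x y]; rewrite !inE ?linear0 // => /eqP fx /eqP fy.
by rewrite linearP fx fy scaler0 addr0.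
Qed.

HB.instance Definition _ := GRing.isSubmodClosed.Build R X kerpred kerpred_closed.

Record kerm := Kerm { kval : X; _ : kval \in kerpred }.

HB.instance Definition _ := [isSub for kval].
HB.instance Definition _ := [Choice of kerm by <:].
HB.instance Definition _ := [SubChoice_isSubLmodule of kerm by <:].

Fact kval_linear : linear kval. Proof. by []. Qed.

(* Opaque, so that simplification does not unfold it to [kval]. *)
Fact kerin_subproof : {i : {linear kerm -> X} | i =1 kval}.
Proof. by exists (mklin kval_linear). Qed.
Definition kerin : {linear kerm -> X} := sval kerin_subproof.

Lemma kerin_val : kerin =1 kval.
Proof. by rewrite /kerin; case: kerin_subproof. Qed.

Lemma kerinE (x : kerm) : f (kerin x) = 0.
Proof. by rewrite kerin_val; case: x => x /= /eqP. Qed.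

Lemma kerin_inj : injective kerin.
Proof. by move=> x y; rewrite !kerin_val; exact: val_inj. Qed.

Lemma kerinP x : f x = 0 <-> exists y, x = kerin y.
Proof.
split=> [fx|[y ->]]; last exact: kerinE.
by exists (@Kerm x (introT eqP fx)); rewrite kerin_val.
Qed.

Lemma short_exact_ker : onto f -> short_exact kerin f.
Proof. by move=> Hf; split=> //; [exact: kerin_inj|exact: kerinP]. Qed.

End Kernel.

Lemma corestr_inj A B X (i : {linear A -> B}) (f : {linear X -> B}) :
  injective i -> (forall x, exists a, f x = i a) ->
  exists g : {linear X -> A}, forall x, i (g x) = f x.
Proof.
move=> ii H; have [g Hg] := choice H.
have L : linear g.
  by move=> a x y; apply: ii; rewrite linearP -!Hg linearP.
by exists (mklin L) => x; rewrite -Hg.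
Qed.

Section Hom.
Variables X Y : lmodType R.

Definition hompred : {pred (X -> Y)} := [pred f : X -> Y | `[< linear f >]].

Fact hompred_closed : submod_closed hompred.
Proof.
split=> [|a f g].
  by apply/asboolP => a x y /=; rewrite scaler0 addr0.
move=> /asboolP Hf /asboolP Hg; apply/asboolP => b x y.
rewrite [LHS]/(a *: f _ + g _) [RHS]/(b *: (a *: f _ + g _) + (a *: f _ + g _)).
rewrite Hf Hg !scalerDr !scalerA [a * b]mulrC.
exact: addrACA.
Qed.

HB.instance Definition _ :=
  GRing.isSubmodClosed.Build R (X -> Y) hompred hompred_closed.

(** Hom(X, Y) as an R-module, to which finite generation and chain conditions apply; [hlin] leads
    back to bundled linear maps. *)
Record homm := Homm { hval : X -> Y; _ : hval \in hompred }.

HB.instance Definition _ := [isSub for hval].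
HB.instance Definition _ := [Choice of homm by <:].
HB.instance Definition _ := [SubChoice_isSubLmodule of homm by <:].

Fact hval_linear (f : homm) : linear (hval f).
Proof. by case: f => f /= /asboolP. Qed.

(* Opaque, so that rewriting does not see through it to [hval]. *)
Fact hlin_subproof (f : homm) : {g : {linear X -> Y} | g =1 hval f}.
Proof. by exists (mklin (hval_linear f)). Qed.
Definition hlin (f : homm) : {linear X -> Y} := sval (hlin_subproof f).

Lemma hlinE (f : homm) : hlin f =1 hval f.
Proof. by rewrite /hlin; case: hlin_subproof. Qed.

Fact homm_of_subproof (f : {linear X -> Y}) : (f : X -> Y) \in hompred.
Proof. by apply/asboolP; exact: linearP. Qed.
Definition homm_of (f : {linear X -> Y}) : homm := Homm (homm_of_subproof f).

Lemma hlinB (f g : homm) x : hlin (f - g) x = hlin f x - hlin g x.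
Proof. by rewrite !hlinE. Qed.
Lemma hlinD (f g : homm) x : hlin (f + g) x = hlin f x + hlin g x.
Proof. by rewrite !hlinE. Qed.
Lemma hlinZ a (f : homm) x : hlin (a *: f) x = a *: hlin f x.
Proof. by rewrite !hlinE. Qed.
Lemma hlin0 x : hlin 0 x = 0.
Proof. by rewrite hlinE. Qed.
Lemma homm_ofE f x : hlin (homm_of f) x = f x.
Proof. by rewrite hlinE. Qed.
Lemma hommP (f g : homm) : (forall x, hlin f x = hlin g x) <-> f = g.
Proof. 
split=> [H|->//]; apply: val_inj; apply/funext => x.
by move: (H x); rewrite !hlinE. Qed.

End Hom.

Section RowModules.
Variable n : nat.

Fact lincomb_linear M (g : 'I_n -> M) : linear (fun v : 'rV[R]_n => \sum_i v 0 i *: g i).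
Proof.
move=> a u v; rewrite scaler_sumr -big_split; apply: eq_bigr => i _ /=.
by rewrite !mxE scalerDl scalerA.
Qed.
Definition lincomb M (g : 'I_n -> M) := mklin (lincomb_linear g).

Lemma lincombE M (g : 'I_n -> M) v : lincomb g v = \sum_i v 0 i *: g i.
Proof. by []. Qed.

Lemma rV_linE M (f : {linear 'rV[R]_n -> M}) v :
  f v = \sum_i v 0 i *: f (delta_mx 0 i).
Proof.
by rewrite {1}[v]row_sum_delta linear_sum; apply: eq_bigr => i _; rewrite linearZ.
Qed.

Lemma rV_lift E B (q : {linear E -> B}) (g : {linear 'rV[R]_n -> B}) :
  onto q -> exists l : {linear 'rV[R]_n -> E}, forall x, q (l x) = g x.
Proof.
move=> /ontoX [s sK]; exists (lincomb (fun i => s (g (delta_mx 0 i)))) => x.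
rewrite lincombE linear_sum [RHS]rV_linE.
by apply: eq_bigr => i _; rewrite linearZ sK.
Qed.

Lemma rV_mulmx m (g : {linear 'rV[R]_n -> 'rV[R]_m}) :
  exists A : 'M[R]_(n, m), forall v, g v = v *m A.
Proof. by exists (lin1_mx g) => v; rewrite mul_rV_lin1. Qed.

End RowModules.

Lemma fg_cover M : finitely_generated M <->
  exists n (p : {linear 'rV[R]_n -> M}), onto p.
Proof.
split=> [[n [g Hg]]|[n [p Hp]]]; exists n.
  exists (lincomb g) => x; have [c ->] := Hg x; exists (\row_i c i).
  by rewrite lincombE; apply: eq_bigr => i _; rewrite mxE.
exists (fun i => p (delta_mx 0 i)) => x; have [v <-] := Hp x.
by exists (fun i => v 0 i); rewrite rV_linE.
Qed.

(** The positive rank puts matrix lifts of endomorphisms in the nonzero ring ['M[R]_n.+1], where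
    [horner_mx] evaluates polynomials. *)
Lemma fg_coverS M : finitely_generated M ->
  exists n (p : {linear 'rV[R]_n.+1 -> M}), onto p.
Proof.
move=> /fg_cover [n [p po]].
have L : linear (fun v : 'rV[R]_(1 + n) => p (rsubmx v)).
  by move=> c u v; rewrite !linearP.
exists n, (mklin L) => y; have [v <-] := po y.
by exists (row_mx 0 v : 'rV_(1 + n)); rewrite /= row_mxKr.
Qed.

Lemma fg_onto M N (f : {linear M -> N}) : onto f ->
  finitely_generated M -> finitely_generated N.
Proof.
move=> Hf /fg_cover [n [p Hp]]; apply/fg_cover; exists n, (f \o p) => y.
by have [x <-] := Hf y; have [v <-] := Hp x; exists v.
Qed.

Lemma fg_rV n : finitely_generated ('rV[R]_n : lmodType R).
Proof. by apply/fg_cover; exists n, idfun => y; exists y. Qed.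

Lemma fg_prod M N : finitely_generated M -> finitely_generated N ->
  finitely_generated (M * N)%type.
Proof.
move=> /fg_cover [a [p Hp]] /fg_cover [b [q Hq]]; apply/fg_cover.
have L : linear (fun v : 'rV[R]_(a + b) => (p (lsubmx v), q (rsubmx v))).
  by move=> c u v; rewrite !linearP.
exists (a + b)%N, (mklin L) => -[x y]; have [u <-] := Hp x; have [v <-] := Hq y.
by exists (row_mx u v); rewrite /= row_mxKl row_mxKr.
Qed.

End LinearMaps.

Arguments inlp {R X Y}.
Arguments inrp {R X Y}.
Arguments kerin {R X Y} f.
Arguments kerm {R X Y} f.

(** * Noetherian modules and stable equality *)

Section Span.
Variable R : comNzRingType.
Implicit Types M N X Y : lmodType R.

(** Recursion on the generators makes splitting off one of them definitional, which is the shape of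
    the inductions below. *)
Fixpoint lspan M (s : seq M) (x : M) : Prop :=
  if s is y :: s' then exists a : R, lspan s' (x - a *: y) else x = 0.

Definition submod M (S : set M) : Prop :=
  [/\ S 0, forall x y, S x -> S y -> S (x + y) & forall a x, S x -> S (a *: x)].

Lemma submod_sum M (S : set M) I (r : seq I) (F : I -> M) : submod S ->
  (forall i, S (F i)) -> S (\sum_(i <- r) F i).
Proof.
by move=> [S0 SD _] H; elim/big_ind: _ => // x y; exact: SD.
Qed.

Lemma submodB M (S : set M) x y : submod S -> S x -> S y -> S (x - y).
Proof. by move=> [_ SD SZ] Sx Sy; rewrite -scaleN1r; apply: SD => //; apply: SZ. Qed.

Lemma lspan_submod M (s : seq M) : submod (lspan s).
Proof.
elim: s => [|y s [S0 SD SZ]] /=.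
  by split=> [|x y -> ->|a x ->]; rewrite ?addr0 ?scaler0.
split=> [|x z [a Ha] [b Hb]|b x [a Ha]].
- by exists 0; rewrite scale0r subr0.
- by exists (a + b); rewrite scalerDl opprD addrACA; apply: SD.
- by exists (b * a); rewrite -scalerA -scalerBr; apply: SZ.
Qed.

Lemma lspan_incl M (s : seq M) (S : set M) x : submod S ->
  (forall y, y \in s -> S y) -> lspan s x -> S x.
Proof.
move=> HS; have [S0 SD SZ] := HS.
elim: s x => [|y s IH] x /= H; first by move=> ->.
move=> [a Ha]; rewrite -[x](subrK (a *: y)); apply: SD.
  by apply: IH Ha => z zs; apply: H; rewrite inE zs orbT.
by apply: SZ; apply: H; rewrite inE eqxx.
Qed.

Lemma lspan_mem M (s : seq M) y : y \in s -> lspan s y.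
Proof.
elim: s => //= z s IH; rewrite inE => /orP [/eqP ->|/IH H].
  by exists 1; rewrite scale1r subrr; case: (lspan_submod s).
by exists 0; rewrite scale0r subr0.
Qed.

Lemma lspan_sub M (s t : seq M) x :
  (forall y, y \in s -> y \in t) -> lspan s x -> lspan t x.
Proof.
by move=> H; apply: lspan_incl => [|y /H/lspan_mem//]; exact: lspan_submod.
Qed.

Lemma lspan_sum M n (g : 'I_n -> M) (c : 'I_n -> R) :
  lspan [seq g i | i <- enum 'I_n] (\sum_i c i *: g i).
Proof.
have HS := lspan_submod [seq g i | i <- enum 'I_n].
apply: submod_sum => // i; case: HS => _ _; apply; apply: lspan_mem.
by apply: map_f; rewrite mem_enum.
Qed.

Lemma lspan_nth M (s : seq M) x :
  lspan s x <-> exists c : 'I_(size s) -> R, x = \sum_i c i *: s`_i.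
Proof.
split=> [|[c ->]].
  elim: s x => [|y s IH] x /=; first by move=> ->; exists (fun=> 0); rewrite big_ord0.
  move=> [a /IH [c Hc]]; exists (fun i => if unlift ord0 i is Some j then c j else a).
  rewrite big_ord_recl unlift_none /= -[x](subrK (a *: y)) Hc addrC; congr (_ + _).
  by apply: eq_bigr => i _; rewrite liftK.
apply: submod_sum (lspan_submod s) _ => i.
by case: (lspan_submod s) => _ _; apply; apply/lspan_mem/mem_nth.
Qed.

Lemma fg_lspan M : finitely_generated M <-> exists s : seq M, forall x, lspan s x.
Proof.
split=> [[n [g H]]|[s H]].
  by exists [seq g i | i <- enum 'I_n] => x; have [c ->] := H x; apply: lspan_sum.
exists (size s), (fun i => s`_i) => x; exact/lspan_nth.
Qed.

Lemma lspan_mapP M N (f : {linear M -> N}) s y : lspan (map f s) y ->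
  exists2 x, lspan s x & f x = y.
Proof.
elim: s y => [|z s IH] y /=; first by move=> ->; exists 0; rewrite ?linear0.
move=> [a /IH [x Hx e]]; exists (x + a *: z); first by exists a; rewrite addrK.
by rewrite linearD linearZ e subrK.
Qed.

Hypothesis noethR : is_noetherian R.

(** The coefficients of [y] in elements of [S], taken modulo the span of [s], form an ideal. Lifts
    of its finitely many generators, together with generators of the part of [S] inside the span of
    [s], generate [S]. *)
Lemma noeth_lspan M (s : seq M) (S : set M) : submod S ->
  (forall x, S x -> lspan s x) -> exists t, forall x, S x <-> lspan t x.
Proof.
elim: s S => [|y s IH] S HS H.
  exists [::] => x; split=> [/H//|/= ->]; by case: HS.
have [S0 SD SZ] := HS; have [T0 TD TZ] := lspan_submod s.
pose I : set R := fun a => exists2 x, S x & lspan s (x - a *: y).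
have HI : is_ideal I.
  split=> [|a b [x Sx Hx] [z Sz Hz]|a b [x Sx Hx]].
  - by exists 0 => //; rewrite scale0r subr0.
  - by exists (x + z); [exact: SD|rewrite scalerDl opprD addrACA; apply: TD].
  - by exists (a *: x); [exact: SZ|rewrite -scalerA -scalerBr; apply: TZ].
have [n [g Hg]] := noethR HI.
have /choice [z Hz] : forall i, exists x, S x /\ lspan s (x - g i *: y).
  move=> i; have [x Sx Hx] : I (g i).
    apply/Hg; exists (fun j => (j == i)%:R).
    by rewrite (bigD1 i) //= eqxx mul1r big1 ?addr0 // => j /negbTE ->; rewrite mul0r.
  by exists x.
have [|x [_ //]|t Ht] := IH (fun x => S x /\ lspan s x).
  by split=> // [x x' [? ?] [? ?]|a x [? ?]]; split; auto.
pose u := [seq z i | i <- enum 'I_n].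
exists (u ++ t) => x; split; last first.
  apply: lspan_incl => // w; rewrite mem_cat => /orP [/mapP [i _ ->]|/lspan_mem /Ht []//].
  by case: (Hz i).
move=> Sx; have [a Ha] := H _ Sx; have [c Hc] : exists c : 'I_n -> R, a = \sum_i c i * g i.
  by apply/Hg; exists x.
have [_ VD _] := lspan_submod (u ++ t).
rewrite -[x](subrK (\sum_i c i *: z i)); apply: VD; last first.
  by apply: lspan_sub (lspan_sum _ _) => w; rewrite mem_cat => ->.
apply: (@lspan_sub _ t) => [w|]; first by rewrite mem_cat orbC => ->.
apply/Ht; split.
  apply: submodB => //; apply: submod_sum => // i; apply: SZ; by case: (Hz i).
have -> : x - \sum_i c i *: z i = (x - a *: y) - \sum_i c i *: (z i - g i *: y).
  under [in RHS]eq_bigr do rewrite scalerBr scalerA.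
  by rewrite sumrB -scaler_suml -Hc opprB subrKA.
apply: submodB; [exact: lspan_submod|by []|].
apply: submod_sum => [|i]; first exact: lspan_submod.
by apply: TZ; case: (Hz i).
Qed.

Lemma fg_submod M (S : set M) : finitely_generated M -> submod S ->
  exists t, forall x, S x <-> lspan t x.
Proof. by move=> /fg_lspan [s Hs] HS; apply: (noeth_lspan (s := s)). Qed.

Lemma acc M (K : nat -> set M) : finitely_generated M ->
  (forall n, submod (K n)) -> (forall n x, K n x -> K n.+1 x) ->
  exists m0, forall n x, K n x -> K m0 x.
Proof.
move=> fgM HK Kinc.
have Kle n m x : (n <= m)%N -> K n x -> K m x.
  by move=> /subnK <-; elim: (m - n)%N => //= d IH /IH /Kinc.
have HU : submod (fun x => exists n, K n x).
  split=> [|x y [a Ha] [b Hb]|a x [n Hn]].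
  - by exists 0%N; case: (HK 0%N).
  - exists (maxn a b); case: (HK (maxn a b)) => _ D _; apply: D.
      exact: Kle (leq_maxl _ _) Ha.
    exact: Kle (leq_maxr _ _) Hb.
  - by exists n; case: (HK n) => _ _; apply.
have [t Ht] := fg_submod fgM HU.
suff [m0 HN] : exists m0, forall y, y \in t -> K m0 y.
  exists m0 => n x Kx; apply: (lspan_incl (HK m0) HN); apply/Ht; by exists n.
have {Ht} : forall y, y \in t -> exists n, K n y by move=> y /lspan_mem/Ht.
elim: t => [|y t IH] H; first by exists 0%N.
have [|m0 HN] := IH; first by move=> z zt; apply: H; rewrite inE zt orbT.
have [n Hn] := H y (mem_head _ _).
exists (maxn n m0) => z; rewrite inE => /orP [/eqP ->|/HN].
  exact: Kle (leq_maxl _ _) Hn.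
exact: Kle (leq_maxr _ _).
Qed.

Lemma fg_sub X M (i : {linear X -> M}) : injective i ->
  finitely_generated M -> finitely_generated X.
Proof.
move=> ii fgM.
have HS : submod (fun y => exists x, i x = y).
  split=> [|_ _ [x <-] [y <-]|a _ [x <-]].
  - by exists 0; rewrite linear0.
  - by exists (x + y); rewrite linearD.
  - by exists (a *: x); rewrite linearZ.
have [t Ht] := fg_submod fgM HS.
have [u Hu] : exists u : seq X, t = map i u.
  have : forall y, y \in t -> exists x, i x = y by move=> y /lspan_mem/Ht.
  elim: t {Ht} => [|y t IH] H; first by exists [::].
  have [x <-] := H y (mem_head _ _).
  have [|u ->] := IH; last by exists (x :: u).
  by move=> z zt; apply: H; rewrite inE zt orbT.
apply/fg_lspan; exists u => x.
have /Ht : exists x', i x' = i x by exists x.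
by rewrite Hu => /lspan_mapP [z Hz /ii <-].
Qed.

Lemma fg_ker M N (f : {linear M -> N}) : finitely_generated M ->
  finitely_generated (kerm f).
Proof. by apply: fg_sub; exact: kerin_inj. Qed.

Lemma fg_mx a b : finitely_generated ('M[R]_(a, b) : lmodType R).
Proof.
have [i Hi] : exists i : {linear 'M[R]_(a, b) -> 'rV[R]_(a * b)}, injective i.
  by exists mxvec; exact: can_inj mxvecK.
exact: fg_sub Hi (fg_rV _ _).
Qed.

(** Along free covers every homomorphism lifts to a matrix. The matrices that arise form a submodule
    of a finitely generated module, and each determines its homomorphism because [p] is onto. *)
Lemma fg_hom X Y : finitely_generated X -> finitely_generated Y ->
  finitely_generated (homm X Y).
Proof.
move=> /fg_cover [a [p Hp]] /fg_cover [b [q Hq]].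
pose S : set 'M[R]_(a, b) := fun A => exists f : homm X Y,
  forall v, hlin f (p v) = q (v *m A).
have HS : submod S.
  split=> [|A B [f Hf] [g Hg]|c A [f Hf]].
  - by exists 0 => v; rewrite hlin0 mulmx0 linear0.
  - by exists (f + g) => v; rewrite hlinD Hf Hg mulmxDr linearD.
  - by exists (c *: f) => v; rewrite hlinZ Hf -scalemxAr linearZ.
have [t Ht] := fg_submod (fg_mx a b) HS.
have [u Hu] : exists u : seq (homm X Y), forall A f, lspan t A ->
    (forall v, hlin f (p v) = q (v *m A)) -> lspan u f.
  have {Ht} : forall A, A \in t -> S A by move=> y /lspan_mem/Ht.
  elim: t => [|B t IH] H.
    exists [::] => A f /= -> Hf; apply/hommP => x.
    by have [v <-] := Hp x; rewrite Hf hlin0 mulmx0 linear0.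
  have [|u Hu] := IH; first by move=> z zt; apply: H; rewrite inE zt orbT.
  have [g Hg] := H B (mem_head _ _).
  exists (g :: u) => A f [c Hc] Hf; exists c; apply: Hu Hc _ => v.
  by rewrite hlinB hlinZ Hf Hg mulmxBr -scalemxAr linearB [X in _ = _ - X]linearZ.
apply/fg_lspan; exists u => f.
have [l Hl] := rV_lift (hlin f \o p) Hq; have [A HA] := rV_mulmx l.
apply: (Hu A) => [|v]; last by rewrite -HA Hl.
by apply/Ht; exists f => v; rewrite -HA Hl.
Qed.

End Span.

(** * Maps factoring through free modules *)

Section Stable.
Variable R : comNzRingType.
Implicit Types A B D E F M N P X Y Z : lmodType R.

(** [is_basis] lets a generating list repeat elements but tests independence on duplicate-free
    lists; turning multiplicities into coefficients bridges the two. *)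
Lemma sum_seq_count (I : eqType) M (s u : seq I) (F : I -> M) : uniq u ->
  {subset s <= u} -> \sum_(b <- s) F b = \sum_(b <- u) (count_mem b s)%:R *: F b.
Proof.
move=> Uu; elim: s => [|b s IH] H.
  by rewrite big_nil big1 // => b _; rewrite scale0r.
rewrite big_cons IH => [|x xs]; last by apply: H; rewrite inE xs orbT.
under [RHS]eq_bigr do rewrite /= natrD scalerDl.
rewrite big_split /=; congr (_ + _).
rewrite (bigD1_seq b) //=; last by apply: H; rewrite mem_head.
rewrite eqxx scale1r big1 ?addr0 // => x /negbTE.
by rewrite eq_sym => ->; rewrite scale0r.
Qed.

(** The rank may be infinite, so the lift is read off from one chosen expansion per element.
    Independence of the basis is what makes it linear. *)
Lemma free_lift F E B (q : {linear E -> B}) (h : {linear F -> B}) :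
  is_free F -> onto q -> exists l : {linear F -> E}, forall x, q (l x) = h x.
Proof.
move=> [S [gen indep]] /ontoX [s sK].
have /choice [rep Hrep] x : exists r : seq F * (F -> R),
    (forall b, b \in r.1 -> S b) /\ x = \sum_(b <- r.1) r.2 b *: b.
  by have [t [c Hc]] := gen x; exists (t, c).
pose l x := \sum_(b <- (rep x).1) (rep x).2 b *: s (h b).
have L : linear l.
  move=> a x y; apply/eqP; rewrite eq_sym -subr_eq0; apply/eqP.
  (* A common duplicate-free support on which the expansions of x, y and a x + y can be compared. *)
  pose u := undup ((rep x).1 ++ (rep y).1 ++ (rep (a *: x + y)).1).
  have Uu : uniq u by exact: undup_uniq.
  have uS b : b \in u -> S b.
    rewrite mem_undup !mem_cat => /or3P [] H.
    - exact: (Hrep x).1.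
    - exact: (Hrep y).1.
    - exact: (Hrep _).1 H.
  pose co x b := (count_mem b (rep x).1)%:R * (rep x).2 b.
  have lE z (V : lmodType R) (G : F -> V) : {subset (rep z).1 <= u} ->
      \sum_(b <- (rep z).1) (rep z).2 b *: G b = \sum_(b <- u) co z b *: G b.
    by move=> H; rewrite (sum_seq_count _ Uu H); apply: eq_bigr => b _; rewrite scalerA.
  have sx : {subset (rep x).1 <= u} by move=> b Hb; rewrite mem_undup !mem_cat Hb.
  have sy : {subset (rep y).1 <= u} by move=> b Hb; rewrite mem_undup !mem_cat Hb orbT.
  have sz : {subset (rep (a *: x + y)).1 <= u}.
    by move=> b Hb; rewrite mem_undup !mem_cat Hb !orbT.
  rewrite /l !lE // scaler_sumr -big_split -sumrB big1_seq // => b /= bu.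
  rewrite scalerA -scalerDl -scalerBl.
  suff -> : a * co x b + co y b - co (a *: x + y) b = 0 by rewrite scale0r.
  apply: (indep u (fun b => a * co x b + co y b - co (a *: x + y) b)) bu => //.
  under eq_bigr do rewrite scalerBl scalerDl -scalerA.
  rewrite sumrB big_split -scaler_sumr /= -!(lE _ _ id) //.
  by rewrite -(Hrep x).2 -(Hrep y).2 -(Hrep (a *: x + y)).2 subrr.
exists (mklin L) => x; rewrite /= /l linear_sum [in RHS](Hrep x).2 linear_sum.
by apply: eq_bigr => b _; rewrite !linearZ /= sK.
Qed.

Lemma rV_free n : is_free ('rV[R]_n : lmodType R).
Proof.
exists (fun v => exists i, v = delta_mx 0 i); split.
  move=> x; exists [seq delta_mx 0 i | i <- enum 'I_n], (fun b => (x *m b^T) 0 0).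
  split=> [b /mapP [i _ ->]|]; first by exists i.
  rewrite big_map big_enum /= {1}[x]row_sum_delta; apply: eq_bigr => i _; congr (_ *: _).
  by rewrite trmx_delta -colE mxE.
move=> s c Us Hs H b bs; have [j bj] := Hs _ bs.
have := congr1 (fun v : 'rV_n => v 0 j) H; rewrite summxE mxE.
have bj1 : b 0 j = 1 by rewrite bj mxE !eqxx.
rewrite (bigD1_seq b) //= mxE bj1 mulr1 big1_seq ?addr0 // => b'.
move=> /andP [nb /Hs [i bi]]; rewrite bi !mxE eqxx /=.
case: eqP => [ji|_]; last by rewrite mulr0.
by case/eqP: nb; rewrite bi bj ji.
Qed.

Definition st0 M N (f : M -> N) : Prop := factors_through_free f.

Lemma st0_rV M N n (w : {linear M -> 'rV[R]_n}) (q : {linear 'rV[R]_n -> N}) f :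
  (forall x, f x = q (w x)) -> st0 f.
Proof. by move=> H; exists 'rV[R]_n, w, q; split=> //; exact: rV_free. Qed.

(** Replaces a free module of unknown rank by any prescribed cover of the target. With a finite free
    cover of [N], two stably zero maps factor through the same module and can be added there. *)
Lemma st0_onto M N E (q : {linear E -> N}) f : onto q -> st0 f ->
  exists w : {linear M -> E}, forall x, f x = q (w x).
Proof.
move=> Hq [F [g [h [fF H]]]]; have [l Hl] := free_lift h fF Hq.
by exists (l \o g) => x; rewrite H /= Hl.
Qed.

Lemma eq_st0 M N (f g : M -> N) : f =1 g -> st0 f -> st0 g.
Proof. by move=> /funext ->. Qed.

Lemma st0_0 M N : st0 (fun _ : M => 0 : N).
Proof.
apply: (@st0_rV _ _ 0 (\0 : {linear M -> 'rV[R]_0}) (\0 : {linear 'rV[R]_0 -> N})).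
by [].
Qed.

Lemma st0_comp M N X (f : M -> N) (h : {linear N -> X}) : st0 f -> st0 (h \o f).
Proof. by move=> [F [g [k [fF H]]]]; exists F, g, (h \o k); split=> // x /=; rewrite H. Qed.

Lemma st0_pre M N X (f : M -> N) (h : {linear X -> M}) : st0 f -> st0 (f \o h).
Proof. by move=> [F [g [k [fF H]]]]; exists F, (g \o h), k; split=> // x /=; rewrite H. Qed.

Lemma st0_opp M N (f : M -> N) : st0 f -> st0 (fun x => - f x).
Proof. by move=> [F [g [k [fF H]]]]; exists F, g, (\- k); split=> // x /=; rewrite H. Qed.

Lemma st0_scale M N (f : M -> N) a : st0 f -> st0 (fun x => a *: f x).
Proof. by move=> [F [g [k [fF H]]]]; exists F, g, (a \*: k); split=> // x /=; rewrite H. Qed.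

Lemma st0_add M N (f g : M -> N) : finitely_generated N ->
  st0 f -> st0 g -> st0 (fun x => f x + g x).
Proof.
move=> /fg_cover [n [q Hq]] /(st0_onto Hq) [u Hu] /(st0_onto Hq) [v Hv].
by apply: (@st0_rV _ _ n (u \+ v) q) => x /=; rewrite linearD Hu Hv.
Qed.

Lemma steq_refl M N (f : M -> N) : stable_eq f f.
Proof. by apply: eq_st0 (st0_0 M N) => x; rewrite subrr. Qed.

Lemma steq_eq M N (f g : M -> N) : f =1 g -> stable_eq f g.
Proof. by move=> /funext ->; exact: steq_refl. Qed.

Lemma steq_sym M N (f g : M -> N) : stable_eq f g -> stable_eq g f.
Proof. by move=> /st0_opp; apply: eq_st0 => x; rewrite opprB. Qed.

Lemma steq_trans M N (f g h : M -> N) : finitely_generated N ->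
  stable_eq f g -> stable_eq g h -> stable_eq f h.
Proof.
by move=> fN H1 H2; apply: eq_st0 (st0_add fN H1 H2) => x; rewrite addrA subrK.
Qed.

Lemma steq_comp M N X (f g : M -> N) (h : {linear N -> X}) :
  stable_eq f g -> stable_eq (h \o f) (h \o g).
Proof. by move=> /(st0_comp h); apply: eq_st0 => x /=; rewrite linearB. Qed.

Lemma steq_pre M N X (f g : M -> N) (h : {linear X -> M}) :
  stable_eq f g -> stable_eq (f \o h) (g \o h).
Proof. exact: (st0_pre h). Qed.

Lemma steq_add M N (f g f' g' : M -> N) : finitely_generated N ->
  stable_eq f g -> stable_eq f' g' ->
  stable_eq (fun x => f x + f' x) (fun x => g x + g' x).
Proof.
by move=> fN H1 H2; apply: eq_st0 (st0_add fN H1 H2) => x; rewrite opprD addrACA.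
Qed.

Lemma steq_st0 M N (f g : M -> N) : finitely_generated N ->
  stable_eq f g -> st0 g -> st0 f.
Proof.
by move=> fN H1 H2; apply: eq_st0 (st0_add fN H1 H2) => x; rewrite subrK.
Qed.

End Stable.

(** * Cohen-Macaulay modules *)

Section Ext.
Variable R : comNzRingType.
Implicit Types A B D E M N S T X Y : lmodType R.

Definition extends S X (i : {linear S -> X}) : Prop :=
  forall phi : {linear S -> R^o}, exists psi : {linear X -> R^o},
    forall x, psi (i x) = phi x.

(* [ext_vanishes j M] is the vanishing of Ext^(j+1)(M, R), read off from an
   arbitrary j-th syzygy. *)
Fixpoint ext_vanishes (j : nat) M : Prop :=
  forall n S (i : {linear S -> 'rV[R]_n}) (p : {linear 'rV[R]_n -> M}),
    short_exact i p -> if j is j'.+1 then ext_vanishes j' S else extends i.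

Definition stable_retract X M : Prop :=
  exists (f : {linear X -> M}) (g : {linear M -> X}), stable_eq (g \o f) id.

Lemma stable_retract_refl M : stable_retract M M.
Proof. by exists idfun, idfun; exact: steq_refl. Qed.

(** Lifts of f and g to the covers restrict to the syzygies. Since id - g f factors through [q] by
    some v, the defect id - lg lf - v q on the cover takes values in [T]; this is [w], and it
    exhibits [T] as a stable retract of [S] with an explicit factorization through the cover. *)
Lemma syzygy_retract M N a b S T (i : {linear S -> 'rV[R]_a})
    (p : {linear 'rV[R]_a -> M}) (j : {linear T -> 'rV[R]_b})
    (q : {linear 'rV[R]_b -> N}) :
  short_exact i p -> short_exact j q -> stable_retract N M ->
  exists (l : {linear 'rV[R]_b -> 'rV[R]_a}) (f : {linear T -> S})
    (g : {linear S -> T}) (w : {linear 'rV[R]_b -> T}),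
    (forall x, i (f x) = l (j x)) /\ (forall x, x = g (f x) + w (j x)).
Proof.
move=> [ii po ip] [ji qo jq] [f [g fg]].
have [lf Hf] := rV_lift (f \o q) po; have [lg Hg] := rV_lift (g \o p) qo.
have [v Hv] := st0_onto qo (steq_sym fg).
have ipj x : p (i x) = 0 by apply/ip; exists x.
have jqj x : q (j x) = 0 by apply/jq; exists x.
have [|fS HfS] := corestr_inj (f := lf \o j) ii.
  by move=> x; apply/ip; rewrite /= Hf /= jqj linear0.
have [|gS HgS] := corestr_inj (f := lg \o i) ji.
  by move=> x; apply/jq; rewrite /= Hg /= ipj linear0.
have [|w Hw] := corestr_inj (f := idfun \- (lg \o lf) \- (v \o q)) ji.
  by move=> x; apply/jq; rewrite /= !linearB /= -Hv Hg /= Hf /= subrr.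
exists lf, fS, gS, w; split=> [x|x]; first exact: HfS.
apply: ji; rewrite linearD HgS Hw /= HfS /=.
by rewrite jqj linear0 subr0 addrC subrK.
Qed.

Lemma extends_retract M N a b S T (i : {linear S -> 'rV[R]_a})
    (p : {linear 'rV[R]_a -> M}) (j : {linear T -> 'rV[R]_b})
    (q : {linear 'rV[R]_b -> N}) :
  short_exact i p -> short_exact j q -> stable_retract N M ->
  extends i -> extends j.
Proof.
move=> Hi Hj NM ei phi.
have [l [f [g [w [Hl Hw]]]]] := syzygy_retract Hi Hj NM.
have [psi Hpsi] := ei (phi \o g).
exists ((psi \o l) \+ (phi \o w)) => x /=.
by rewrite -Hl Hpsi /= -linearD -Hw.
Qed.

Hypothesis noethR : is_noetherian R.

Lemma fg_syzygy M n S (i : {linear S -> 'rV[R]_n}) (p : {linear 'rV[R]_n -> M}) :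
  short_exact i p -> finitely_generated S.
Proof. by move=> [ii _ _]; exact: (fg_sub noethR ii (fg_rV R n)). Qed.

Lemma syzygy_exists M : finitely_generated M -> exists n S
  (i : {linear S -> 'rV[R]_n}) (p : {linear 'rV[R]_n -> M}), short_exact i p.
Proof.
by move=> /fg_cover [n [p Hp]]; exists n, (kerm p), (kerin p), p; exact: short_exact_ker.
Qed.

Lemma ext_retract j M N : finitely_generated M -> stable_retract N M ->
  ext_vanishes j M -> ext_vanishes j N.
Proof.
elim: j M N => [|j IH] M N fM NM H b T k q Hj;
  have [a [S [i [p Hi]]]] := syzygy_exists fM.
  exact: extends_retract Hi Hj NM (H _ _ _ _ Hi).
have [l [f [g [w [Hl Hw]]]]] := syzygy_retract Hi Hj NM.
apply: IH (fg_syzygy Hi) _ (H _ _ _ _ Hi); exists f, g; apply: steq_sym.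
by apply: (@st0_rV _ _ _ _ k w) => x; rewrite [X in X - _]Hw addrC addKr.
Qed.

(** [ext_vanishes] quantifies over all syzygies, but one suffices: any two are compared through [M]
    as a stable retract of itself, in the manner of Schanuel's lemma. *)
Lemma ext0_syzygy M n S (i : {linear S -> 'rV[R]_n}) (p : {linear 'rV[R]_n -> M}) :
  short_exact i p -> extends i -> ext_vanishes 0 M.
Proof.
move=> Hi ei b T k q Hj; exact: extends_retract Hi Hj (stable_retract_refl M) ei.
Qed.

Lemma extS_syzygy j M n S (i : {linear S -> 'rV[R]_n}) (p : {linear 'rV[R]_n -> M}) :
  short_exact i p -> ext_vanishes j S -> ext_vanishes j.+1 M.
Proof.
move=> Hi eS b T k q Hj.
have [l [f [g [w [Hl Hw]]]]] := syzygy_retract Hi Hj (stable_retract_refl M).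
apply: ext_retract (fg_syzygy Hi) _ eS; exists f, g; apply: steq_sym.
by apply: (@st0_rV _ _ _ _ k w) => x; rewrite [X in X - _]Hw addrC addKr.
Qed.

(** [B] is the pushout of [A] and R^n along the kernel of a free cover of [D]. A functional on [A]
    therefore extends to [B] once its pullback to that kernel extends to R^n. *)
Lemma ext_lift A B D (i : {linear A -> B}) (p : {linear B -> D}) :
  finitely_generated D -> ext_vanishes 0 D -> short_exact i p -> extends i.
Proof.
move=> /fg_cover [n [q qo]] eD [ii po ip] phi.
have [l Hl] := rV_lift q po.
have ipi x : p (i x) = 0 by apply/ip; exists x.
have [|t Ht] := corestr_inj (f := l \o kerin q) ii.
  by move=> x; apply/ip; rewrite /= Hl kerinE.
have [psi Hpsi] := eD _ _ _ _ (short_exact_ker qo) (phi \o t).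
have s_onto : onto ((i \o fst) \+ (l \o snd) : {linear (A * 'rV[R]_n)%type -> B}).
  move=> b; have [x Hx] := qo (p b).
  have /ip [a Ha] : p (b - l x) = 0 by rewrite linearB Hl Hx subrr.
  by exists (a, x); rewrite /= -Ha subrK.
have [|g Hg] := factor_onto s_onto (w := (phi \o fst) \+ (psi \o snd)).
  move=> [a x] /= H.
  have /kerinP [y Hy] : q x = 0.
    by have := congr1 p H; rewrite linearD ipi Hl add0r linear0.
  rewrite Hy Hpsi /= -linearD.
  suff -> : a + t y = 0 by rewrite linear0.
  by apply: ii; rewrite linearD linear0 Ht -[RHS]H Hy.
exists g => x; have /= := Hg (x, 0).
by rewrite !linear0 !addr0.
Qed.

Lemma ext_lift_rV A B D n (i : {linear A -> B}) (p : {linear B -> D})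
    (phi : {linear A -> 'rV[R]_n}) :
  finitely_generated D -> ext_vanishes 0 D -> short_exact i p ->
  exists psi : {linear B -> 'rV[R]_n}, forall x, psi (i x) = phi x.
Proof.
move=> fD eD Hi.
have co_lin j : linear (fun x => phi x 0 j : R^o).
  by move=> a x y; rewrite linearP !mxE.
have /choice [psi Hpsi] : forall j, exists psi : {linear B -> R^o},
    forall x, psi (i x) = phi x 0 j.
  by move=> j; exact: (ext_lift fD eD Hi (mklin (co_lin j))).
have L : linear (fun b => \row_j (psi j b : R)).
  by move=> a x y; apply/rowP => j; rewrite !mxE linearP.
by exists (mklin L) => x; apply/rowP => j; rewrite mxE Hpsi.
Qed.

(* The contravariant exact sequence of stable Hom groups, at its middle term. *)
Lemma stable_exact A B D M (i : {linear A -> B}) (p : {linear B -> D})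
    (u : {linear B -> M}) :
  finitely_generated D -> ext_vanishes 0 D -> finitely_generated M ->
  short_exact i p -> st0 (u \o i) ->
  exists v : {linear D -> M}, stable_eq u (v \o p).
Proof.
move=> fD eD /fg_cover [n [q qo]] Hi /(st0_onto qo) [b Hb].
have [b' Hb'] := ext_lift_rV b fD eD Hi.
case: (Hi) => _ po ip.
have [|v Hv] := factor_onto po (w := u \- (q \o b')).
  by move=> x /ip [y ->] /=; rewrite Hb' -Hb /= subrr.
by exists v; apply: (@st0_rV _ _ _ _ b' q) => x; rewrite /= Hv /= subKr.
Qed.

(** Dimension shift: the resolution without its first term resolves the kernel of the
    augmentation. *)
Lemma ext_of_Ext j M : finitely_generated M ->
  Ext_eq0 j.+1 M R^o -> ext_vanishes j M.
Proof.
elim: j M => [|j IH] M fM [P HP].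
  apply: (ext0_syzygy (short_exact_ker (@fr_aug_surj _ _ P))) => phi.
  have [|d Hd] := corestr_inj (f := fr_diff P 0) (@kerin_inj _ _ _ (fr_aug P)).
  by move=> x; apply/kerinP/fr_exact0; exists x.
  have [|g Hg] := HP (phi \o d).
    move=> x /=; suff -> : d (fr_diff P 1 x) = 0 by rewrite linear0.
    apply: (@kerin_inj _ _ _ (fr_aug P)); rewrite Hd linear0.
    by apply/fr_exactS; exists x.
  exists g => x; have /(fr_exact0) [y Hy] := kerinE x.
  by rewrite Hy -Hg /=; congr (phi _); apply: (@kerin_inj _ _ _ (fr_aug P)); rewrite Hd.
have Hs := short_exact_ker (@fr_aug_surj _ _ P).
apply: (extS_syzygy Hs); apply: IH; first exact: fg_syzygy Hs.
have [|d Hd] := corestr_inj (f := fr_diff P 0) (@kerin_inj _ _ _ (fr_aug P)).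
  by move=> x; apply/kerinP/fr_exact0; exists x.
have dX x : d x = 0 <-> fr_diff P 0 x = 0.
  split=> H; first by rewrite -(Hd x) H linear0.
  by apply: (@kerin_inj _ _ _ (fr_aug P)); rewrite Hd H linear0.
have [Q1 Q2 Q3] : [/\ forall y, exists x, d x = y,
   forall x, d x = 0 <-> exists y, x = fr_diff P 1 y
   & forall n x, fr_diff P n.+1 x = 0 <-> exists y, x = fr_diff P n.+2 y].
  split=> [y|x|n x]; last exact: fr_exactS.
    have /fr_exact0 [x Hx] := kerinE y; exists x.
    by apply: (@kerin_inj _ _ _ (fr_aug P)); rewrite Hd Hx.
  by rewrite dX; exact: fr_exactS.
by exists (@FreeResolution _ _ (fun n => fr_rank P n.+1) (fun n => fr_diff P n.+1)
  d Q1 Q2 Q3); exact: HP.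
Qed.

Lemma Ext_of_syzygies (Z : nat -> lmodType R) (rk : nat -> nat)
    (k : forall n, {linear Z n.+1 -> 'rV[R]_(rk n)})
    (p : forall n, {linear 'rV[R]_(rk n) -> Z n}) :
  (forall n, short_exact (k n) (p n)) -> (forall n, extends (k n)) ->
  forall i, (0 < i)%N -> Ext_eq0 i (Z 0) R^o.
Proof.
move=> kp ek.
pose d n : {linear 'rV[R]_(rk n.+1) -> 'rV[R]_(rk n)} := k n \o p n.+1.
have po n : onto (p n) by case: (kp n).
have pd n x : p n x = 0 <-> exists y, x = d n y.
  case: (kp n) => _ _ H; split=> [/H [y ->]|[y ->]].
    by have [z <-] := po n.+1 y; exists z.
  by apply/H; exists (p n.+1 y).
have dd n x : d n x = 0 <-> exists y, x = d n.+1 y.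
  rewrite -pd; case: (kp n) => ki _ _; split=> H.
    by apply: ki; rewrite -[LHS]/(d n x) H linear0.
  by rewrite /d /= H linear0.
move=> [//|i] _.
exists (@FreeResolution _ _ rk d (p 0) (po 0) (pd 0) dd) => f Hf.
have [|g Hg] := factor_onto (po i.+1) (w := f).
  by move=> x /pd [y ->]; exact: Hf.
have [psi Hpsi] := ek i g.
by exists psi => x; rewrite -Hg -Hpsi.
Qed.

Lemma Ext_of_ext M : finitely_generated M -> (forall j, ext_vanishes j M) ->
  forall i, (0 < i)%N -> Ext_eq0 i M R^o.
Proof.
move=> fM eM.
have cov (N : {N : lmodType R | finitely_generated N}) :
    {n : nat & {p : {linear 'rV[R]_n -> sval N} | onto p}}.
  have [n Hn] := cid ((fg_cover _).1 (svalP N)); have [p Hp] := cid Hn.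
  by exists n, p.
(* Modules are bundled with finite generation so that taking a syzygy can be iterated; the
   Noetherian hypothesis keeps the kernels in this type. *)
pose step (N : {N : lmodType R | finitely_generated N}) : {N : lmodType R | finitely_generated N} :=
  exist _ (kerm (sval (projT2 (cov N))) : lmodType R)
    (fg_ker noethR (sval (projT2 (cov N))) (fg_rV R _)).
pose Z n := iter n step (exist _ M fM).
have kp n : short_exact (kerin (sval (projT2 (cov (Z n))))) (sval (projT2 (cov (Z n)))).
  exact: short_exact_ker (svalP (projT2 (cov (Z n)))).
have eZ n j : ext_vanishes j (sval (Z n)).
  elim: n j => [|n IH] j; first exact: eM.
  exact: (IH j.+1 _ _ _ _ (kp n)).
apply: (Ext_of_syzygies kp) => n; exact: (eZ n 0%N _ _ _ _ (kp n)).
Qed.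

Lemma cm_extP M : cohen_macaulay M <->
  finitely_generated M /\ forall j, ext_vanishes j M.
Proof.
split=> [[fM H]|[fM H]]; split=> //.
  by move=> j; apply: ext_of_Ext => //; exact: H.
exact: Ext_of_ext.
Qed.

Lemma cm_fg M : cohen_macaulay M -> finitely_generated M.
Proof. by case. Qed.

Lemma cm_ext0 M : cohen_macaulay M -> ext_vanishes 0 M.
Proof. by move=> /cm_extP []. Qed.

Lemma cm_retract M N : cohen_macaulay M -> finitely_generated N ->
  stable_retract N M -> cohen_macaulay N.
Proof.
move=> /cm_extP [fM eM] fN NM; apply/cm_extP; split=> // j.
exact: ext_retract fM NM (eM j).
Qed.

Lemma cm_syzygy M n S (i : {linear S -> 'rV[R]_n}) (p : {linear 'rV[R]_n -> M}) :
  short_exact i p -> cohen_macaulay M -> cohen_macaulay S.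
Proof.
move=> Hi /cm_extP [_ eM]; apply/cm_extP; split; first exact: fg_syzygy Hi.
by move=> j; exact: (eM j.+1 _ _ _ _ Hi).
Qed.

(** A free module is a stable retract of zero, and a syzygy of zero is isomorphic to its cover,
    hence again free. *)
Lemma ext_rV j n : ext_vanishes j ('rV[R]_n : lmodType R).
Proof.
suff H0 M : (forall x : M, x = 0) -> ext_vanishes j M.
  have e0 : ext_vanishes j ('rV[R]_0 : lmodType R).
    by apply: H0 => x; apply/rowP; case.
  apply: ext_retract (fg_rV R 0) _ e0.
  by exists \0, \0; apply: steq_sym; apply: (@st0_rV _ _ _ _ idfun idfun) => x; rewrite /= subr0.
elim: j M => [|j IH] M M0 n' S i p [ii po ip].
  have io : onto i by move=> y; have /ip [x ->] := M0 (p y); exists x.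
  move=> phi; apply: (factor_onto io) => x Hx.
  by have -> : x = 0; [apply: ii; rewrite Hx linear0|rewrite linear0].
have io : onto i by move=> y; have /ip [x ->] := M0 (p y); exists x.
have i0 x : i x = 0 -> x = 0 by move=> Hx; apply: ii; rewrite Hx linear0.
have [g [ig gi]] := linear_bij_inv (linear_bijP i0 io).
have z0 : ext_vanishes j ('rV[R]_0 : lmodType R).
  by apply: IH => x; apply/rowP; case.
apply: ext_retract (fg_rV R 0) _ z0.
by exists \0, \0; apply: steq_sym; apply: (@st0_rV _ _ _ _ i g) => x; rewrite /= subr0 ig.
Qed.

Lemma cm_rV n : cohen_macaulay ('rV[R]_n : lmodType R).
Proof. by apply/cm_extP; split; [exact: fg_rV|move=> j; exact: ext_rV]. Qed.

Lemma short_exact_prod M N a b S T (i : {linear S -> 'rV[R]_a})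
    (p : {linear 'rV[R]_a -> M}) (j : {linear T -> 'rV[R]_b})
    (q : {linear 'rV[R]_b -> N}) :
  short_exact i p -> short_exact j q ->
  exists (k : {linear (S * T)%type -> 'rV[R]_(a + b)})
    (r : {linear 'rV[R]_(a + b) -> (M * N)%type}),
    short_exact k r /\ forall s t, k (s, t) = row_mx (i s) (j t).
Proof.
move=> [ii po ip] [ji qo jq].
have L1 : linear (fun s : S * T => row_mx (i s.1) (j s.2)).
  by move=> c u v; rewrite /= !linearP scale_row_mx add_row_mx.
have L2 : linear (fun v : 'rV[R]_(a + b) => (p (lsubmx v), q (rsubmx v))).
  by move=> c u v; rewrite !linearP.
exists (mklin L1), (mklin L2); split=> //; split=> /=.
- by move=> [s t] [s' t'] /eq_row_mx /= [/ii -> /ji ->].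
- move=> [x y]; have [u <-] := po x; have [v <-] := qo y.
  by exists (row_mx u v); rewrite row_mxKl row_mxKr.
- move=> x; split=> [[/ip [s Hs] /jq [t Ht]]|[[s t] ->]].
    by exists (s, t); rewrite -Hs -Ht hsubmxK.
  rewrite row_mxKl row_mxKr; congr pair; [apply/ip|apply/jq]; by [exists s|exists t].
Qed.

Lemma ext_prod j M N : finitely_generated M -> finitely_generated N ->
  ext_vanishes j M -> ext_vanishes j N -> ext_vanishes j (M * N)%type.
Proof.
elim: j M N => [|j IH] M N fM fN eM eN;
  have [a [S [i [p Hi]]]] := syzygy_exists fM;
  have [b [T [k [q Hk]]]] := syzygy_exists fN;
  have [l [r [Hl lE]]] := short_exact_prod Hi Hk.
  apply: (ext0_syzygy Hl) => phi.
  have [f Hf] := eM _ _ _ _ Hi (phi \o inlp).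
  have [g Hg] := eN _ _ _ _ Hk (phi \o inrp).
  exists ((f \o lsubmx) \+ (g \o rsubmx)) => st; rewrite [in RHS](prod_split st) linearD.
  by case: st => s t; rewrite /= lE row_mxKl row_mxKr Hf Hg.
by apply: (extS_syzygy Hl); apply: IH; [exact: fg_syzygy Hi|exact: fg_syzygy Hk|
  exact: eM Hi|exact: eN Hk].
Qed.

Lemma cm_prod M N : cohen_macaulay M -> cohen_macaulay N ->
  cohen_macaulay (M * N)%type.
Proof.
move=> /cm_extP [fM eM] /cm_extP [fN eN]; apply/cm_extP.
by split=> [|j]; [exact: fg_prod|exact: ext_prod].
Qed.

Fact row_inl_linear a b : linear (fun u : 'rV[R]_a => row_mx u (0 : 'rV[R]_b)).
Proof. by move=> c u v; rewrite scale_row_mx add_row_mx scaler0 addr0. Qed.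
Definition row_inl a b : {linear 'rV[R]_a -> 'rV[R]_(a + b)} := mklin (@row_inl_linear a b).

(** The last clause of this horseshoe lemma places [S] inside the first summand R^a, so that a
    functional on R^(a+b) extending one on [S] can be restricted to R^a. *)
Lemma horseshoe E D A a b S T (i : {linear A -> E}) (p : {linear E -> D})
    (k : {linear S -> 'rV[R]_a}) (q : {linear 'rV[R]_a -> A})
    (l : {linear T -> 'rV[R]_b}) (r : {linear 'rV[R]_b -> D}) :
  short_exact i p -> short_exact k q -> short_exact l r ->
  exists (K : lmodType R) (n : {linear K -> 'rV[R]_(a + b)}) (s : {linear 'rV[R]_(a + b) -> E})
    (f : {linear S -> K}) (g : {linear K -> T}),
    [/\ short_exact n s, short_exact f g & forall x, n (f x) = row_mx (k x) 0].
Proof.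
move=> [ii po ip] [ki qo kq] [li ro lr].
have [t Ht] := rV_lift r po.
have ipi x : p (i x) = 0 by apply/ip; exists x.
have kqk x : q (k x) = 0 by apply/kq; exists x.
have lrl x : r (l x) = 0 by apply/lr; exists x.
have sL : linear (fun v : 'rV[R]_(a + b) => i (q (lsubmx v)) + t (rsubmx v)).
  by move=> c u v; rewrite !linearP scalerDr addrACA.
pose s := mklin sL.
have sE v : s v = i (q (lsubmx v)) + t (rsubmx v) by [].
have so : onto s.
  move=> e; have [v Hv] := ro (p e).
  have /ip [x Hx] : p (e - t v) = 0 by rewrite linearB Ht Hv subrr.
  have [u Hu] := qo x; exists (row_mx u v).
  by rewrite sE row_mxKl row_mxKr Hu -Hx subrK.
have [|f Hf] := corestr_inj (f := row_inl a b \o k) (@kerin_inj _ _ _ s).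
  by move=> x; apply/kerinP; rewrite sE /= row_mxKl row_mxKr kqk !linear0 addr0.
have [|g Hg] := corestr_inj (f := rsubmx \o kerin s) li.
  move=> x; apply/lr; have := congr1 p (kerinE x); rewrite sE linearD ipi Ht add0r.
  by rewrite linear0.
exists (kerm s), (kerin s), s, f, g; split=> //; first exact: short_exact_ker.
have kf x : kerin s (f x) = row_mx (k x) 0 by rewrite Hf.
split=> [x y H|y|x].
- by have := kf x; rewrite H kf => /eq_row_mx [/ki ->].
- have /ip [x Hx] : p (t (l y)) = 0 by rewrite Ht lrl.
  have [u Hu] := qo (- x).
  have [z Hz] : exists z, row_mx u (l y) = kerin s z.
    by apply/kerinP; rewrite sE row_mxKl row_mxKr Hu Hx linearN addNr.
  by exists z; apply: li; rewrite Hg /= -Hz row_mxKr.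
- split=> [H|[y ->]]; last by apply: li; rewrite Hg linear0 /= kf row_mxKr.
  have r0 : rsubmx (kerin s x) = 0 by have := Hg x; rewrite H linear0.
  have := kerinE x; rewrite sE r0 linear0 addr0 -(linear0 i) => /ii /kq [y Hy].
  exists y; apply: (@kerin_inj _ _ _ s); rewrite kf -Hy -[LHS]hsubmxK.
  by rewrite r0.
Qed.

(** The horseshoe gives syzygies 0 -> S -> K -> T -> 0. A functional on S extends to K because
    Ext^1(T, R) = Ext^2(D, R) = 0, then to the cover of E because Ext^1(E, R) = 0. In higher degrees
    the syzygies satisfy the same hypotheses. *)
Lemma ext_kernel j E D A (i : {linear A -> E}) (p : {linear E -> D}) :
  finitely_generated E -> finitely_generated D -> short_exact i p ->
  (forall l, ext_vanishes l E) -> (forall l, ext_vanishes l D) -> ext_vanishes j A.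
Proof.
elim: j E D A i p => [|j IH] E D A i p fE fD Hi eE eD;
  have [b [T [l [r Hl]]]] := syzygy_exists fD;
  have [ii _ _] := Hi;
  have [a [S [k [q Hk]]]] := syzygy_exists (fg_sub noethR ii fE);
  have [K [n [s [f [g [Hs Hf nf]]]]]] := horseshoe Hi Hk Hl.
  apply: (ext0_syzygy Hk) => phi.
  have [psi0 Hpsi0] := ext_lift (fg_syzygy Hl) (eD 1%N _ _ _ _ Hl) Hf phi.
  have [psi Hpsi] := eE 0%N _ _ _ _ Hs psi0.
  by exists (psi \o row_inl a b) => x /=; rewrite -nf Hpsi.
apply: (extS_syzygy Hk); apply: (IH _ _ _ f g) => //.
- exact: fg_syzygy Hs.
- exact: fg_syzygy Hl.
- by move=> c; exact: (eE c.+1 _ _ _ _ Hs).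
- by move=> c; exact: (eD c.+1 _ _ _ _ Hl).
Qed.

Lemma cm_kernel E D A (i : {linear A -> E}) (p : {linear E -> D}) :
  short_exact i p -> cohen_macaulay E -> cohen_macaulay D -> cohen_macaulay A.
Proof.
move=> Hi /cm_extP [fE eE] /cm_extP [fD eD]; apply/cm_extP; split.
  by case: (Hi) => ii _ _; exact: (fg_sub noethR ii fE).
move=> j.
exact (@ext_kernel j E D A i p fE fD Hi eE eD).
Qed.

End Ext.

(** * Local endomorphism rings *)

Section Ideals.
Variable R : comNzRingType.
Implicit Types I J : set R.

Lemma idealT : is_ideal (setT : set R). Proof. by []. Qed.

Lemma ideal_mul_ideal I J : is_ideal I -> is_ideal (ideal_mul I J).
Proof.
move=> [I0 ID IZ]; split.
- by exists 0%N, (fun=> 0), (fun=> 0); split=> [[]//|]; rewrite big_ord0.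
- move=> x y [n [a [b [Hab ->]]]] [n' [a' [b' [Hab' ->]]]].
  exists (n + n')%N, (fun i => match fintype.split i with inl j => a j | inr j => a' j end),
    (fun i => match fintype.split i with inl j => b j | inr j => b' j end); split.
    by move=> i; case: fintype.split.
  rewrite big_split_ord /=; congr (_ + _); apply: eq_bigr => i _.
    by rewrite (unsplitK (inl i)).
  by rewrite (unsplitK (inr i)).
- move=> c x [n [a [b [Hab ->]]]].
  exists n, (fun i => c * a i), b; split=> [i|].
    by have [? ?] := Hab i; split=> //; apply: IZ.
  by rewrite mulr_sumr; apply: eq_bigr => i _; rewrite mulrA.
Qed.

Lemma ideal_mul_mem I J x y : I x -> J y -> ideal_mul I J (x * y).
Proof.
move=> Ix Jy; exists 1%N, (fun=> x), (fun=> y); split=> //.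
by rewrite big_ord_recl big_ord0 addr0.
Qed.

Lemma ideal_mulS I J J' x : (forall y, J y -> J' y) -> ideal_mul I J x -> ideal_mul I J' x.
Proof.
move=> H [n [a [b [Hab ->]]]]; exists n, a, b; split=> // i.
by have [? /H] := Hab i.
Qed.

Lemma idealB I x y : is_ideal I -> I x -> I y -> I (x - y).
Proof. by move=> [_ ID IZ] Ix Iy; rewrite -mulN1r; apply: ID => //; apply: IZ. Qed.

Lemma ideal_sum I (T : Type) (r : seq T) (F : T -> R) : is_ideal I ->
  (forall i, I (F i)) -> I (\sum_(i <- r) F i).
Proof. by move=> [I0 ID _] H; elim/big_ind: _ => // x y; exact: ID. Qed.

Variables (m : set R).
Hypotheses (m_ideal : is_ideal m) (m_complete : is_adically_complete m).

Lemma ideal_exp_ideal n : is_ideal (ideal_exp m n).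
Proof. by case: n => [|n]; [exact: idealT|exact: ideal_mul_ideal]. Qed.

Lemma ideal_expS n x : ideal_exp m n.+1 x -> ideal_exp m n x.
Proof. by elim: n x => // n IH x; apply: ideal_mulS. Qed.

Lemma ideal_exp1 x : ideal_exp m 1 x <-> m x.
Proof.
split=> [[n [a [b [H ->]]]]|mx]; last by rewrite -[x]mulr1; exact: ideal_mul_mem.
apply: ideal_sum => // i; rewrite mulrC.
by case: m_ideal => _ _; apply; case: (H i).
Qed.

Lemma ideal_expS1 n x : ideal_exp m n.+1 x -> m x.
Proof. by elim: n x => [|n IH] x; [move/ideal_exp1|move/ideal_expS/IH]. Qed.

Lemma ideal_exp_mem n x : m x -> ideal_exp m n (x ^+ n).
Proof. by move=> mx; elim: n => //= n IH; rewrite exprS; exact: ideal_mul_mem. Qed.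

Lemma adic_separated x : (forall n, ideal_exp m n x) -> x = 0.
Proof.
move=> H; have [|y [_ Hy]] := m_complete (u := fun=> 0).
  by move=> n; rewrite subrr; case: (ideal_exp_ideal n).
rewrite -(Hy x) ?(Hy 0) // => n; rewrite ?subr0 //.
by case: (ideal_exp_ideal n).
Qed.

Lemma one_sub_unit x : m x -> exists y, (1 - x) * y = 1.
Proof.
move=> mx; have [|y [Hy _]] := m_complete (u := fun n => \sum_(i < n) x ^+ i).
  by move=> n; rewrite big_ord_recr addrC addKr; exact: ideal_exp_mem.
exists y; apply/eqP; rewrite -subr_eq0; apply/eqP/adic_separated => n.
have -> : (1 - x) * y - 1 = (1 - x) * (y - \sum_(i < n) x ^+ i) - x ^+ n.
  rewrite mulrBr -[x ^+ n](subrK 1) subrX1; ring.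
apply: idealB; [exact: ideal_exp_ideal| |exact: ideal_exp_mem].
by case: (ideal_exp_ideal n) => _ _; apply.
Qed.

Definition coefs_in n (q : {poly R}) : Prop := forall i, ideal_exp m n q`_i.

Lemma coefs_in0 n : coefs_in n 0.
Proof. by move=> i; rewrite coef0; case: (ideal_exp_ideal n). Qed.

Lemma coefs_inD n p q : coefs_in n p -> coefs_in n q -> coefs_in n (p + q).
Proof. by move=> Hp Hq i; rewrite coefD; case: (ideal_exp_ideal n) => _ H _; apply: H. Qed.

Lemma coefs_inM n p q : coefs_in n p -> coefs_in n (p * q).
Proof.
move=> Hp i; rewrite coefM; apply: ideal_sum; first exact: ideal_exp_ideal.
by move=> j; rewrite mulrC; case: (ideal_exp_ideal n) => _ _; apply.
Qed.

(** One extra power of [m] per squaring is far from optimal, but it makes the Newton iterates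
    converge. *)
Lemma coefs_in_sqr n p : coefs_in n.+1 p -> coefs_in n.+2 (p * p).
Proof.
move=> Hp i; rewrite coefM; apply: ideal_sum; first exact: ideal_exp_ideal.
by move=> j; apply: (@ideal_mul_mem m (ideal_exp m n.+1) _ _ (ideal_expS1 (Hp j)) (Hp _)).
Qed.

Lemma coefs_inS n p : coefs_in n.+1 p -> coefs_in n p.
Proof. by move=> H i; exact: ideal_expS. Qed.

Variable chi : {poly R}.
Hypothesis chi_monic : chi \is monic.
Local Notation "q %r" := (Pdiv.CommonRing.rmodp q chi) (at level 2, format "q %r").

Lemma rmodp_eq p q r : p = q + r * chi -> p%r = q%r.
Proof. by move=> ->; rewrite rmodpD // rmodp_mull // addr0. Qed.

Lemma rmodp_idem p : (p%r)%r = p%r.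
Proof. by rewrite -[X in X%r]mul1r rmodp_mulmr // mul1r. Qed.

Lemma rmodpB p q : (p - q)%r = p%r - q%r.
Proof. by rewrite rmodpD // -scaleN1r rmodpZ // scaleN1r. Qed.

Lemma coefs_in_rmodp n p : coefs_in n p -> coefs_in n p%r.
Proof.
move=> Hp; rewrite -[p]coefK poly_def.
elim/big_ind: _ => [|x y|i _].
- by rewrite Pdiv.CommonRing.rmod0p; exact: coefs_in0.
- by rewrite rmodpD //; exact: coefs_inD.
- rewrite rmodpZ // => j; rewrite coefZ mulrC.
  by case: (ideal_exp_ideal n) => _ _; apply.
Qed.

(* Newton iteration q |-> 3 q^2 - 2 q^3 modulo [chi]; the limit exists because R
   is complete and remainders modulo [chi] have bounded degree. *)
Lemma lift_idempotent (b : {poly R}) : coefs_in 1 (b * b - b)%r ->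
  exists e, (e * e - e)%r = 0 /\ coefs_in 1 (e - b%r).
Proof.
move=> Hb.
pose N (q : {poly R}) : {poly R} := 3%:R * q ^+ 2 - 2%:R * q ^+ 3.
pose q n := iter n (fun q => (N q)%r) b%r.
have qr n : (q n)%r = q n by case: n => [|n]; rewrite /q /= rmodp_idem.
have A n : coefs_in n.+1 (q n * q n - q n)%r.
  elim: n => [|n IH].
    by rewrite rmodpB /= rmodp_mulml // rmodp_mulmr // rmodp_idem -rmodpB.
  set z := q n * q n - q n in IH.
  (* With z = q^2 - q, the Newton step satisfies N(q)^2 - N(q) = z^2 (4 z - 3) and N(q) - q = z (1 -
     2 q). The first identity improves idempotency, the second makes the sequence Cauchy. *)
  have -> : (q n.+1 * q n.+1 - q n.+1)%r
      = (z%r * z%r * (4%:R * z - 3%:R))%r.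
    rewrite rmodpB /= rmodp_mulml // rmodp_mulmr // rmodp_idem -rmodpB.
    rewrite -mulrA rmodp_mulml // mulrCA rmodp_mulml //.
    by congr (_%r); rewrite /N /z; ring.
  by apply: coefs_in_rmodp; apply: coefs_inM; exact: coefs_in_sqr.
have B n : coefs_in n.+1 (q n.+1 - q n).
  rewrite -(qr n.+1) -(qr n) -rmodpB.
  have -> : (q n.+1 - q n)%r = ((q n * q n - q n)%r * (1 - 2%:R * q n))%r.
    rewrite rmodpB /= rmodp_idem -rmodpB rmodp_mulml //; congr (_%r); rewrite /N; ring.
  by apply: coefs_in_rmodp; apply: coefs_inM.
have sq n : (size (q n) <= size chi)%N.
  rewrite -qr; apply: ltnW; apply: Pdiv.CommonRing.ltn_rmodpN0.
  exact: monic_neq0.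
have /choice [x Hx] i : exists x, forall n, ideal_exp m n (x - (q n)`_i).
  have [|x [Hx _]] := m_complete (u := fun n => (q n)`_i); last by exists x.
  by move=> n; rewrite -coefB; apply: ideal_expS; exact: B.
pose e := \poly_(i < size chi) x i.
have Hq n : coefs_in n (e - q n).
  move=> i; rewrite coefB coef_poly; case: ltnP => // Hi.
  by rewrite nth_default ?subrr ?(leq_trans (sq n)) //; case: (ideal_exp_ideal n).
exists e; split.
  apply/polyP => i; rewrite coef0; apply: adic_separated => n.
  suff: coefs_in n (e * e - e)%r by apply.
  have -> : e * e - e = (q n * q n - q n) + (e - q n) * (e + q n - 1) by ring.
  rewrite rmodpD //; apply: coefs_inD; first exact: coefs_inS.
  by apply: coefs_in_rmodp; apply: coefs_inM.
have -> : e - b%r = (e - q 1%N) + (q 1%N - q 0%N) by rewrite subrKA.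
by apply: coefs_inD; [exact: Hq|exact: B].
Qed.

End Ideals.

(** * The residue map and endomorphisms of indecomposable modules *)

Section ResidueField.
Variables (k : fieldType) (R : comAlgType k) (m : set R).
Hypotheses (m_ideal : is_ideal m) (m_res : has_residue_field m).

Lemma residue_map : exists rho : {rmorphism R -> k},
  (forall x, rho x = 0 <-> m x) /\ (forall c, rho c%:A = c).
Proof.
have [m0 mD mZ] := m_ideal.
have /choice [r Hr] : forall x : R, exists c : k, m (x - c%:A).
  by move=> x; have [c [Hc _]] := m_res x; exists c.
have rE x c : m (x - c%:A) -> r x = c.
  move=> H; have [c' [_ Hc']] := m_res x.
  by rewrite -(Hc' c) // (Hc' (r x)).
have radd : zmod_morphism r.
  move=> x y; apply: rE; rewrite scalerBl.
  have -> : x - y - ((r x)%:A - (r y)%:A) = (x - (r x)%:A) - (y - (r y)%:A) by ring.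
  exact: idealB.
have rmul : monoid_morphism r.
  split=> [|x y]; apply: rE; first by rewrite scale1r subrr.
  have -> : (r x * r y)%:A = (r x)%:A * (r y)%:A :> R by rewrite -in_algE rmorphM.
  have -> : x * y - (r x)%:A * (r y)%:A =
    y * (x - (r x)%:A) + (r x)%:A * (y - (r y)%:A) by ring.
  by apply: mD; apply: mZ.
pose rho : {rmorphism R -> k} := HB.pack r
  (GRing.isZmodMorphism.Build _ _ r radd) (GRing.isMonoidMorphism.Build _ _ r rmul).
exists rho; split=> [x|c]; last by apply: rE; rewrite subrr.
split=> [H|mx]; last by apply: rE; rewrite scale0r subr0.
by have := Hr x; rewrite -[r x]/(rho x) H scale0r subr0.
Qed.

End ResidueField.

Lemma poly_split0 (R : comNzRingType) (p : {poly R}) :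
  exists h : {poly R}, p = h * 'X + (p`_0)%:P.
Proof.
elim/poly_ind: p => [|h c _]; first by exists 0; rewrite coef0 mul0r add0r.
by exists h; rewrite coefD coefMX coefC add0r.
Qed.

Section LocalEndomorphisms.
Variables (k : fieldType) (R : comAlgType k) (m : set R) (rho : {rmorphism R -> k}).
Hypotheses (m_ideal : is_ideal m) (m_complete : is_adically_complete m).
Hypotheses (rho_ker : forall x, rho x = 0 <-> m x) (rhoA : forall c, rho c%:A = c).
Implicit Types U A B : lmodType R.

Lemma rho_unit x : rho x != 0 -> exists y, x * y = 1.
Proof.
move=> Hx; pose c := (rho x)^-1; pose z := 1 - c%:A * x.
have mz : m z.
  by apply/rho_ker; rewrite rmorphB rmorphM rmorph1 rhoA mulVf ?subrr.
have [y Hy] := one_sub_unit m_ideal m_complete mz.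
by exists (c%:A * y); rewrite -[RHS]Hy /z subKr mulrA [x * _]mulrC.
Qed.

Lemma det_unit n (T : 'M[R]_n) : map_mx rho T = 1%:M -> exists y, \det T * y = 1.
Proof. by move=> HT; apply: rho_unit; rewrite -det_map_mx HT det1 oner_eq0. Qed.

Lemma horner_mx_stable n U (p : {linear 'rV[R]_n.+1 -> U}) (A : 'M[R]_n.+1) q v :
  (forall v, p v = 0 -> p (v *m A) = 0) -> p v = 0 -> p (v *m horner_mx A q) = 0.
Proof.
move=> HA; elim/poly_ind: q v => [|q c IH] v Hv.
  by rewrite rmorph0 mulmx0 linear0.
rewrite rmorphD rmorphM /= horner_mx_X horner_mx_C mulmxDr linearD mulmxA.
by rewrite HA ?IH // mul_mx_scalar linearZ /= Hv scaler0 add0r.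
Qed.

(** The determinant of [T] is a unit, but the inverse matrix must also respect the kernel of [p].
    Cayley-Hamilton writes it, up to a unit scalar, as a polynomial in [T], and such polynomials
    preserve that kernel. *)
Lemma bijective_of_residue n U (p : {linear 'rV[R]_n.+1 -> U}) (t : {linear U -> U})
    (T : 'M[R]_n.+1) : onto p -> (forall v, t (p v) = p (v *m T)) ->
  map_mx rho T = 1%:M -> bijective t.
Proof.
move=> po tT /det_unit [d Hd].
have [h Hh] := poly_split0 (char_poly T).
have := Cayley_Hamilton T; rewrite Hh char_poly_det.
set c := _ * \det T => CH; have [d' Hd'] : exists d', d' * c = 1.
  exists ((-1) ^+ n.+1 * d); rewrite /c mulrACA -expr2 sqrr_sign mul1r mulrC; exact: Hd.
move: CH Hd'; clearbody c => CH Hd'.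
have stT v : p v = 0 -> p (v *m T) = 0 by move=> Hv; rewrite -tT Hv linear0.
have cE v : c *: v = - (v *m (horner_mx T h *m T)).
  have e : horner_mx T h *m T + c%:M = 0.
    by rewrite -[RHS]CH rmorphD rmorphM /= horner_mx_X horner_mx_C.
  by apply/eqP; rewrite -addr_eq0 addrC -mul_mx_scalar -mulmxDr e mulmx0.
have hT : horner_mx T h *m T = T *m horner_mx T h.
  have : horner_mx T (h * 'X) = horner_mx T ('X * h) by rewrite mulrC.
  by rewrite !rmorphM /= horner_mx_X.
have pc v : p v = - (d' *: p (v *m (horner_mx T h *m T))).
  by rewrite -scalerN -linearN -cE linearZ /= scalerA Hd' scale1r.
apply: linear_bijP => [x|y].
  have [v <-] := po x; rewrite tT => Hv.
  by rewrite pc hT mulmxA horner_mx_stable // scaler0 oppr0.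
have [v <-] := po y; exists (p (- d' *: (v *m horner_mx T h))).
by rewrite [RHS]pc tT -scalemxAl -mulmxA linearZ /= scaleNr.
Qed.

Lemma idempotent_indecomposable U (e : {linear U -> U}) :
  indecomposable U -> (forall x, e (e x) = e x) ->
  (forall x, e x = 0) \/ (forall x, e x = x).
Proof.
move=> [_ HU] ee; pose e' : {linear U -> U} := idfun \- e.
have [|a Ha] := corestr_inj (f := e') (@kerin_inj _ _ _ e).
  by move=> x; apply/kerinP; rewrite /e' /= linearB ee subrr.
have [|b Hb] := corestr_inj (f := e) (@kerin_inj _ _ _ e').
  by move=> x; apply/kerinP; rewrite /e' /= ee subrr.
have L : linear (fun x => (a x, b x)) by move=> c x y; rewrite !linearP.
have [|H|H] := HU (kerm e) (kerm e').
- exists (mklin L); apply: linear_bijP => [x /= [H1 H2]|[y z]].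
    have -> : x = kerin e (a x) + kerin e' (b x) by rewrite Ha Hb /e' /= subrK.
    by rewrite H1 H2 !linear0 addr0.
  exists (kerin e y + kerin e' z); congr pair.
    apply: (@kerin_inj _ _ _ e); rewrite Ha /e' /= linearD kerinE add0r.
    have := kerinE z; rewrite /e' => /= /eqP; rewrite subr_eq0 => /eqP <-.
    by rewrite addrK.
  apply: (@kerin_inj _ _ _ e'); rewrite Hb linearD kerinE add0r.
  by have := kerinE z; rewrite /e' => /= /eqP; rewrite subr_eq0 => /eqP <-.
- right=> x; apply/eqP; rewrite eq_sym -subr_eq0.
  by rewrite -[x - e x]/(e' x) -(Ha x) (H (a x)) linear0.
- by left=> x; rewrite -(Hb x) (H (b x)) linear0.
Qed.

Lemma coefs_in1 (q : {poly R}) : coefs_in m 1 q <-> map_poly rho q = 0.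
Proof.
split=> [H|H i].
  by apply/polyP => i; rewrite coef_map coef0; apply/rho_ker/(ideal_exp1 m_ideal)/H.
by apply/(ideal_exp1 m_ideal)/rho_ker; rewrite -coef_map H coef0.
Qed.

(** Fitting decomposition, lifted from the residue field. Modulo m the characteristic polynomial is
    X^a h with h(0) nonzero. The idempotent belonging to this coprime factorization lifts to
    R[X]/(chi) and induces an idempotent [eps] of U, which is 0 or 1. If it is 0, only the factor h
    remains and f is bijective; if it is 1, f is nilpotent modulo m and 1 - f is bijective. *)
Lemma indecomposable_local U (f : {linear U -> U}) :
  finitely_generated U -> indecomposable U ->
  bijective f \/ bijective (fun x => x - f x).
Proof.
move=> /fg_coverS [n [p po]] HU.
have [l Hl] := rV_lift (f \o p) po; have [A HA] := rV_mulmx l.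
have fA v : f (p v) = p (v *m A) by rewrite -HA Hl.
have stA q v : p v = 0 -> p (v *m horner_mx A q) = 0.
  by apply: horner_mx_stable => {}v Hv; rewrite -fA Hv linear0.
have act q : exists g : {linear U -> U}, forall v, g (p v) = p (v *m horner_mx A q).
  have [|g Hg] := factor_onto po (w := p \o mulmxr (horner_mx A q)); last by exists g.
  by move=> v; exact: stA.
pose chi := char_poly A; have chim : chi \is monic := char_poly_monic A.
pose Ab := map_mx rho A.
pose iota := map_poly (in_alg R) : {poly k} -> {poly R}.
have iotaK q : map_poly rho (iota q) = q.
  by apply/polyP => i; rewrite !coef_map /= rhoA.
have chib : map_poly rho chi = char_poly Ab by exact: map_char_poly.
have evr q : horner_mx A (Pdiv.CommonRing.rmodp q chi) = horner_mx A q.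
  by rewrite [in RHS](rdivp_eq chim q) rmorphD rmorphM /= Cayley_Hamilton mulr0 add0r.
have evb q : map_mx rho (horner_mx A q) = horner_mx Ab (map_poly rho q) by exact: map_horner_mx.
have [a [h h0 chiE]] := multiplicity_XsubC (char_poly Ab) 0.
rewrite polyC0 subr0 monic_neq0 ?char_poly_monic //= in h0 chiE.
have [[u v] /= uv] : exists w : {poly k} * {poly k}, w.1 * 'X^a + w.2 * h = 1.
  apply/Bezout_eq1_coprimepP; apply: coprimep_expl.
  by rewrite coprimep_sym -['X]subr0 -polyC0 coprimep_XsubC.
have [|e [e_idem e_res]] := lift_idempotent m_ideal m_complete chim (b := iota (v * h)).
  (* By Bezout the residue of (v h)^2 - v h is -u v times that of [chi]. Adding [iota (u * v) * chi]
     makes the residue exactly zero before the remainder is taken. *)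
  rewrite (@rmodp_eq _ _ chim _ (iota (v * h) * iota (v * h) - iota (v * h)
    + iota (u * v) * chi) (- iota (u * v))); last by ring.
  apply: coefs_in_rmodp => //; apply/coefs_in1.
  rewrite rmorphD rmorphB !rmorphM /= !iotaK chib chiE.
  have -> : v * h * (v * h) - v * h + u * v * (h * 'X^a) =
    v * h * (u * 'X^a + v * h - 1) by ring.
  by rewrite uv subrr mulr0.
pose E := horner_mx A e.
have EE : E *m E = E.
  apply/eqP; rewrite -subr_eq0; apply/eqP.
  have -> : E *m E - E = horner_mx A (e * e - e) by rewrite rmorphB rmorphM.
  by rewrite -evr e_idem rmorph0.
have Eb : map_mx rho E = horner_mx Ab (v * h).
  have /coefs_in1 := e_res; rewrite rmorphB /= => /eqP; rewrite subr_eq0 => /eqP H.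
  by rewrite /E evb H -evb evr evb iotaK.
have [eps Heps] := act e.
have bij_comp (g s t : {linear U -> U}) : (forall x, g (s x) = t x) ->
    (forall x, s (g x) = t x) -> bijective t -> bijective g.
  move=> gs sg [t' tt' t't]; apply: linear_bijP => [x Hx|y].
    by apply: (can_inj tt'); rewrite -sg Hx !linear0.
  by exists (s (t' y)); rewrite gs t't.
have eps_idem x : eps (eps x) = eps x.
  by have [w <-] := po x; rewrite !Heps -mulmxA EE.
pose acts (g : {linear U -> U}) q := forall v, g (p v) = p (v *m horner_mx A q).
have acts_comp g s t q r : acts g q -> acts s r -> acts t (q * r) ->
    (forall x, g (s x) = t x) /\ (forall x, s (g x) = t x).
  move=> Hg Hs Ht; split=> x; have [w <-] := po x; rewrite Ht ?Hg ?Hs ?Hg -mulmxA.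
    by rewrite [q * r]mulrC [horner_mx A (r * q)](rmorphM (horner_mx A)).
  by rewrite [horner_mx A (q * r)](rmorphM (horner_mx A)).
have fX : acts f 'X by move=> w; rewrite horner_mx_X.
have CHb q : horner_mx Ab (q * char_poly Ab) = 0.
  by rewrite rmorphM /= Cayley_Hamilton mulr0.
have [eps0|eps1] := idempotent_indecomposable HU eps_idem.
  left; pose c := h`_0; have c0 : c != 0 by rewrite /c -horner_coef0.
  have [h1 h1E] := poly_split0 h.
  have [s Hs] := act (iota (- c^-1 *: h1)).
  have [t Ht] := act ('X * iota (- c^-1 *: h1)).
  have [fs sf] := acts_comp _ _ _ _ _ fX Hs Ht.
  apply: (bij_comp f s t fs sf).
  (* [G] has constant term 1, so 1 - G is a multiple of X, and the endomorphism it defines factors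
     through f on either side. *)
  pose G := iota (c^-1 *: h).
  have Gt : 'X * iota (- c^-1 *: h1) = 1 - G.
    have -> : G = iota (c^-1 *: h1) * 'X + 1.
      rewrite -[X in _ * X](map_polyX (in_alg R)) -[1](rmorph1 (map_poly (in_alg R))).
      rewrite -rmorphM -rmorphD /G [in LHS]h1E scalerDr -scalerAl -/c.
      have -> : c^-1 *: c%:P = 1 by rewrite -mul_polyC -polyCM mulVf.
      by [].
    by rewrite /iota scaleNr rmorphN /=; ring.
  (* As [eps] is 0, inserting 1 - E changes the matrix but not the map it induces on U. Modulo m the
     new matrix is the identity, since h (1 - v h) = u X^a h vanishes at [Ab]. *)
  apply: (@bijective_of_residue n U p t (1%:M - horner_mx A G *m (1%:M - E)) po).
    move=> w; rewrite Ht Gt rmorphB rmorph1 mulmxBr mulmx1 linearB.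
    rewrite [in RHS]mulmxBr mulmx1 linearB mulmxA mulmxBr mulmx1 [p (_ *m _ - _)]linearB.
    by rewrite -Heps eps0 subr0.
  rewrite map_mxB map_mxM map_mxB !map_mx1 Eb evb iotaK.
  suff -> : horner_mx Ab (c^-1 *: h) *m (1%:M - horner_mx Ab (v * h)) = 0 by rewrite subr0.
  have -> : horner_mx Ab (c^-1 *: h) *m (1%:M - horner_mx Ab (v * h)) =
      horner_mx Ab ((c^-1 *: h) * (1 - v * h)) .
    by rewrite [RHS]rmorphM rmorphB [X in _ = _ * (X - _)](rmorph1 (horner_mx Ab)).
  rewrite -(CHb (c^-1 *: u)) chiE -uv; congr (horner_mx _ _).
  by rewrite -!mul_polyC; ring.
right; have [s Hs] := act (\sum_(i < a) 'X^i).
have [t Ht] := act ((1 - 'X) * \sum_(i < a) 'X^i).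
pose g : {linear U -> U} := idfun \- f.
have Hg : acts g (1 - 'X).
  by move=> w; rewrite /g /= fX rmorphB rmorph1 mulmxBr mulmx1 linearB.
have [gs sg] := acts_comp _ _ _ _ _ Hg Hs Ht.
apply: (bij_comp g s t gs sg).
(* As [eps] is 1, the factor E may be inserted; modulo m the product X^a v h is a multiple of the
   characteristic polynomial and vanishes at [Ab]. *)
apply: (@bijective_of_residue n U p t (1%:M - horner_mx A 'X^a *m E) po) => [w|].
  rewrite Ht; have -> : (1 - 'X) * \sum_(i < a) 'X^i = 1 - 'X^a :> {poly R}.
    by rewrite -opprB mulNr -subrX1 opprB.
  rewrite rmorphB rmorph1 !mulmxBr mulmx1 !linearB /= mulmxA.
  by rewrite -[p (_ *m E)]Heps eps1.
rewrite map_mxB map_mx1 map_mxM Eb evb map_polyXn.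
suff -> : horner_mx Ab 'X^a *m horner_mx Ab (v * h) = 0 by rewrite subr0.
have -> : horner_mx Ab 'X^a *m horner_mx Ab (v * h) = horner_mx Ab ('X^a * (v * h)).
  by rewrite [RHS]rmorphM.
rewrite -(CHb v) chiE; congr (horner_mx _ _); ring.
Qed.

End LocalEndomorphisms.

(** * Decomposition into indecomposables *)

Section ModuleIso.
Variable R : comNzRingType.
Implicit Types A B M N : lmodType R.

Lemma module_isoP M N : module_iso M N <->
  exists (f : {linear M -> N}) (g : {linear N -> M}), cancel f g /\ cancel g f.
Proof.
split=> [[f /linear_bij_inv [g H]]|[f [g [fg gf]]]]; first by exists f, g.
by exists f, g.
Qed.

Lemma module_iso_refl M : module_iso M M.
Proof. by exists idfun, idfun. Qed.

Lemma module_iso_sym M N : module_iso M N -> module_iso N M.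
Proof. by move=> /module_isoP [f [g [fg gf]]]; exists g, f. Qed.

Lemma module_iso_trans N M A : module_iso M N -> module_iso N A -> module_iso M A.
Proof. by move=> [f Hf] [g Hg]; exists (g \o f); exact: bij_comp. Qed.

Lemma module_iso_prod M N A B :
  module_iso M N -> module_iso A B -> module_iso (M * A)%type (N * B)%type.
Proof.
move=> /module_isoP [f [f' [ff ff']]] /module_isoP [g [g' [gg gg']]].
have L : linear (fun x : M * A => (f x.1, g x.2)) by move=> c x y; rewrite /= !linearP.
by exists (mklin L), (fun y => (f' y.1, g' y.2)) => -[x y] /=; rewrite ?ff ?gg ?ff' ?gg'.
Qed.

Lemma module_iso_prodA M N A : module_iso ((M * N) * A)%type (M * (N * A))%type.
Proof.
have L : linear (fun x : (M * N) * A => (x.1.1, (x.1.2, x.2))) by move=> c [[? ?] ?] [[? ?] ?].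
by exists (mklin L), (fun x => ((x.1, x.2.1), x.2.2)) => [[[? ?] ?]|[? [? ?]]].
Qed.

Lemma module_iso_prodCA M N A : module_iso (M * (N * A))%type (N * (M * A))%type.
Proof.
have L : linear (fun x : M * (N * A) => (x.2.1, (x.1, x.2.2))) by move=> c [? [? ?]] [? [? ?]].
by exists (mklin L), (fun x => (x.2.1, (x.1, x.2.2))) => -[? [? ?]].
Qed.

Lemma module_iso_prod0 M : module_iso ('rV[R]_0 * M)%type M.
Proof.
exists snd, (fun y => (0, y)) => [[x y]|y] //=; congr pair; apply/rowP; by case.
Qed.

Lemma module_iso_prod0r M : module_iso (M * 'rV[R]_0)%type M.
Proof.
exists fst, (fun y => (y, 0)) => [[x y]|y] //=; congr pair; apply/rowP; by case.
Qed.

Lemma module_iso_trivial M : trivial_module M -> module_iso M 'rV[R]_0.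
Proof.
move=> H; exists \0, (fun=> 0) => x; first by rewrite [RHS]H.
by apply/rowP; case.
Qed.

Lemma module_iso_retract M N : module_iso M N -> stable_retract M N.
Proof.
by move=> /module_isoP [f [g [fg _]]]; exists f, g; apply: steq_eq => x /=; rewrite fg.
Qed.

Hypothesis noethR : is_noetherian R.

Lemma module_iso_fg M N : module_iso M N -> finitely_generated M -> finitely_generated N.
Proof. by move=> [f [g fg gf]]; apply: (@fg_onto _ _ _ f) => y; exists (g y). Qed.

Lemma module_iso_cm M N : module_iso M N -> cohen_macaulay M -> cohen_macaulay N.
Proof.
move=> H cM; apply: (cm_retract noethR cM (module_iso_fg H (cm_fg cM))).
by apply: module_iso_retract; exact: module_iso_sym.
Qed.

Lemma cm_fst M N : cohen_macaulay (M * N)%type -> cohen_macaulay M.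
Proof.
move=> cMN; apply: (cm_retract noethR cMN).
  by apply: (fg_onto (f := fst) _ (cm_fg cMN)) => x; exists (x, 0).
by exists inlp, fst; apply: steq_eq.
Qed.

Lemma cm_snd M N : cohen_macaulay (M * N)%type -> cohen_macaulay N.
Proof.
move=> cMN; apply: (cm_retract noethR cMN).
  by apply: (fg_onto (f := snd) _ (cm_fg cMN)) => x; exists (0, x).
by exists inrp, snd; apply: steq_eq.
Qed.

Fixpoint cmsum (l : seq (cmType R)) : lmodType R :=
  if l is U :: l' then (U * cmsum l')%type else 'rV[R]_0.

Fixpoint all_indec (l : seq (cmType R)) : Prop :=
  if l is U :: l' then indecomposable U /\ all_indec l' else True.

Lemma cmsum_cm l : cohen_macaulay (cmsum l).
Proof.
elim: l => [|U l IH] /=; first exact: cm_rV.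
by apply: cm_prod => //; exact: cmP.
Qed.

Lemma all_indec_cat l l' : all_indec l -> all_indec l' -> all_indec (l ++ l').
Proof. by move=> + H; elim: l => //= U l IH [HU /IH]. Qed.

Lemma cmsum_cat l l' : module_iso (cmsum l * cmsum l')%type (cmsum (l ++ l')).
Proof.
elim: l => [|U l IH] /=; first exact: module_iso_prod0.
apply: (module_iso_trans (module_iso_prodA _ _ _)).
by apply: module_iso_prod IH; exact: module_iso_refl.
Qed.

(* Otherwise some quotient of M, with maximal kernel among the quotients that
   are CM and not such a sum, would be trivial or indecomposable. *)
Lemma cm_decompose M : cohen_macaulay M ->
  exists l, all_indec l /\ module_iso M (cmsum l).
Proof.
move=> cM; pose good N := exists l, all_indec l /\ module_iso N (cmsum l).
apply: contrapT => badM.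
have goodP A B : good A -> good B -> good (A * B)%type.
  move=> [l [Hl Al]] [l' [Hl' Bl']]; exists (l ++ l'); split; first exact: all_indec_cat.
  exact: module_iso_trans (module_iso_prod Al Bl') (cmsum_cat l l').
have good_iso A B : module_iso A B -> good B -> good A.
  by move=> AB [l [Hl Bl]]; exists l; split=> //; exact: module_iso_trans AB Bl.
pose Q := {L : lmodType R & {p : {linear M -> L} | [/\ onto p, cohen_macaulay L & ~ good L]}}.
pose mkQ (L : lmodType R) (p : {linear M -> L})
    (H : [/\ onto p, cohen_macaulay L & ~ good L]) : Q := existT _ L (exist _ p H).
pose K (q : Q) : set M := fun x => sval (projT2 q) x = 0.
have step (q : Q) : exists q' : Q, (forall x, K q x -> K q' x) /\ exists x, K q' x /\ ~ K q x.
  case: q => L [p [po cL bL]]; rewrite /K /=.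
  have nL : ~ trivial_module L.
    by move=> H; apply: bL; exists [::]; split=> //; exact: module_iso_trivial.
  have iL : ~ indecomposable L.
    move=> H; apply: bL; exists [:: CMType cL]; split=> //=.
    by apply: module_iso_sym; exact: module_iso_prod0r.
  have [A [B [LAB [nA nB]]]] : exists A B, module_iso L (A * B)%type /\
      (~ trivial_module A /\ ~ trivial_module B).
    apply: contrapT => H; apply: iL; split=> // A B LAB; apply: contrapT => H'.
    by apply: H; exists A, B; split=> //; split=> H''; apply: H'; [left|right].
  have cAB := module_iso_cm LAB cL; have cA := cm_fst cAB; have cB := cm_snd cAB.
  have [phi [phi' [pp pp']]] := (module_isoP _ _).1 LAB.
  have nz (N : lmodType R) : ~ trivial_module N -> exists x : N, x <> 0.
    by move=> H; apply: contrapT => H'; apply: H => x; apply: contrapT => Hx; apply: H'; exists x.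
  have [gA|bA] := pselect (good A).
    have bB : ~ good B by move=> gB; apply: bL; apply: good_iso LAB _; exact: goodP.
    have po' : onto (snd \o phi \o p).
      move=> y; have [x Hx] := po (phi' (0, y)); exists x.
      by rewrite /= Hx pp'.
    exists (mkQ B (snd \o phi \o p) (And3 po' cB bB)) => /=.
    split=> [x ->|]; first by rewrite linear0.
    have [a Ha] := nz _ nA; have [x Hx] := po (phi' (a, 0)).
    exists x; rewrite Hx pp'; split=> // /(congr1 phi).
    by rewrite pp' linear0 => -[].
  have po' : onto (fst \o phi \o p).
    move=> y; have [x Hx] := po (phi' (y, 0)); exists x.
    by rewrite /= Hx pp'.
  exists (mkQ A (fst \o phi \o p) (And3 po' cA bA)) => /=.
  split=> [x ->|]; first by rewrite linear0.
  have [b Hb] := nz _ nB; have [x Hx] := po (phi' (0, b)).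
  exists x; rewrite Hx pp'; split=> // /(congr1 phi).
  by rewrite pp' linear0 => -[].
have [next Hnext] := choice step.
have po0 : onto (idfun : M -> M) by move=> y; exists y.
pose q0 : Q := mkQ M idfun (And3 po0 cM badM).
pose q n := iter n next q0.
have [||n0 Hn0] := acc noethR (K := fun n => K (q n)) (cm_fg cM).
- move=> n; split=> [|x y|a x]; rewrite /K ?linear0 //.
    by rewrite linearD => -> ->; rewrite addr0.
  by rewrite linearZ /= => ->; rewrite scaler0.
- by move=> n x; case: (Hnext (q n)) => H _; exact: H.
- by have [_ [x [Hx nx]]] := Hnext (q n0); apply/nx/(Hn0 n0.+1).
Qed.

End ModuleIso.

(** * Finite dimensionality of stable Hom *)

Section Annihilation.
Variable R : comNzRingType.
Hypothesis noethR : is_noetherian R.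
Hypothesis finR : finite_representation_type R.
Implicit Types C M N U V X Y : lmodType R.

Lemma hlin_sum X Y I (r : seq I) (F : I -> homm X Y) x :
  hlin (\sum_(i <- r) F i) x = \sum_(i <- r) hlin (F i) x.
Proof.
elim: r => [|i r IH]; first by rewrite !big_nil hlin0.
by rewrite !big_cons hlinD IH.
Qed.

Lemma submod_st0 X Y : finitely_generated Y ->
  submod (fun f : homm X Y => st0 (hlin f)).
Proof.
move=> fY; split=> [|f g Hf Hg|a f Hf].
- by apply: eq_st0 (st0_0 X Y) => x; rewrite hlin0.
- by apply: eq_st0 (st0_add fY Hf Hg) => x; rewrite hlinD.
- by apply: eq_st0 (st0_scale a Hf) => x; rewrite hlinZ.
Qed.

(** The bound must be independent of [C], because [power_factors] applies it to a module built from
    n. For each listed module L the maps L -> M killed stably by r^n form an ascending chain in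
    Hom(L, M); the maximum of the stabilization indices serves all sums of indecomposables. *)
Lemma uniform_annihilator (r : R) M : cohen_macaulay M ->
  exists n, forall C (c : {linear C -> M}), cohen_macaulay C ->
    st0 (r ^+ n.+1 \*: c) -> st0 (r ^+ n \*: c).
Proof.
move=> cM; have fM := cm_fg cM; have [n0 [L HL]] := finR.
have /choice [N HN] i : exists n, finitely_generated (L i) ->
    forall m (c : {linear L i -> M}), st0 (r ^+ m \*: c) -> st0 (r ^+ n \*: c).
  (* The list may contain modules that are not finitely generated; they get the value 0, about which
     nothing is claimed. *)
  have [fL|nL] := pselect (finitely_generated (L i)); last by exists 0%N.
  have [||n Hn] := acc noethR (K := fun n (c : homm (L i) M) => st0 (hlin (r ^+ n *: c)))
    (fg_hom noethR fL fM).
  - move=> n; have [H0 HD HZ] := submod_st0 (L i) fM.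
    split=> [|f g Hf Hg|a f Hf]; first by rewrite scaler0.
      by rewrite scalerDr; apply: HD.
    by rewrite scalerA mulrC -scalerA; apply: HZ.
  - move=> n c; rewrite exprS -scalerA; have [_ _ HZ] := submod_st0 (L i) fM.
    exact: HZ.
  exists n => _ m c Hc.
  have := Hn m (homm_of c).
  have E j : (r ^+ j \*: c : L i -> M) =1 hlin (r ^+ j *: homm_of c).
    by move=> x; rewrite hlinZ homm_ofE.
  move=> H; apply: (@eq_st0 _ _ _ (hlin (r ^+ n *: homm_of c))).
    by move=> x; rewrite E.
  by apply: H; apply: eq_st0 Hc => x; rewrite E.
pose n := \max_i N i.
have le_n V (c : {linear V -> M}) a b : (a <= b)%N -> st0 (r ^+ a \*: c) -> st0 (r ^+ b \*: c).
  move=> /subnK <- /(st0_scale (r ^+ (b - a))); apply: eq_st0 => x /=.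
  by rewrite scalerA exprD.
exists n => C c cC Hc; have [l [Hl /module_isoP [f [g [fg gf]]]]] := cm_decompose noethR cC.
suff H (c' : {linear cmsum l -> M}) : st0 (r ^+ n.+1 \*: c') -> st0 (r ^+ n \*: c').
  have : st0 (r ^+ n \*: (c \o g)).
    by apply: H; apply: eq_st0 (st0_pre g Hc).
  by move=> /(st0_pre f); apply: eq_st0 => x /=; rewrite fg.
elim: l Hl c' {f g fg gf} => [_ c' _|U l IH [HU Hl] c' Hc'] /=.
  by apply: eq_st0 (st0_0 _ _) => x /=; rewrite (_ : x = 0) ?linear0 ?scaler0 //; apply/rowP; case.
have H1 : st0 (r ^+ n \*: (c' \o inlp)).
  have [i /module_isoP [f [g [fg gf]]]] := HL U HU.
  have fL : finitely_generated (L i).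
    by apply: (@fg_onto _ _ _ f) (cm_fg (cmP U)) => y; exists (g y).
  have : st0 (r ^+ n \*: (c' \o inlp \o g)).
    apply: (le_n _ _ (N i)); first exact: leq_bigmax.
    apply: (HN i fL n.+1); by apply: eq_st0 (st0_pre g (st0_pre inlp Hc')).
  by move=> /(st0_pre f); apply: eq_st0 => x /=; rewrite fg.
have H2 : st0 (r ^+ n \*: (c' \o inrp)).
  by apply: (IH Hl); apply: eq_st0 (st0_pre inrp Hc').
apply: eq_st0 (st0_add fM (st0_pre fst H1) (st0_pre snd H2)) => x /=.
by rewrite -scalerDr -linearD -prod_split.
Qed.

(* The map r^n kills ker r^(n+1) stably, hence factors as v o r^(n+1). *)
Lemma power_factors (r : R) M : cohen_macaulay M ->
  exists n (v : {linear M -> M}), stable_eq (fun x => r ^+ n *: x) (fun x => r ^+ n.+1 *: v x).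
Proof.
move=> cM; have fM := cm_fg cM; have [n Hn] := uniform_annihilator r cM.
have [b [p po]] := (fg_cover M).1 fM.
(* Adding a free cover makes multiplication by r^(n+1) surjective without changing it stably; its
   kernel is then Cohen-Macaulay. *)
pose s : {linear (M * 'rV[R]_b)%type -> M} := (r ^+ n.+1 \*: fst) \+ (p \o snd).
have so : onto s by move=> y; have [w <-] := po y; exists (0, w); rewrite /s /= scaler0 add0r.
have Hs := short_exact_ker so.
have cE : cohen_macaulay (M * 'rV[R]_b)%type by apply: cm_prod => //; exact: cm_rV.
have cC := cm_kernel noethR Hs cE cM.
pose c : {linear kerm s -> M} := fst \o kerin s.
have Hc : st0 (r ^+ n.+1 \*: c).
  apply: (@st0_rV _ _ _ b (\- (snd \o kerin s)) p) => x.
  have /eqP := kerinE x; rewrite {1}/s /= addr_eq0 => /eqP.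
  by rewrite linearN.
have [|v Hv] := stable_exact (u := r ^+ n \*: fst) fM (cm_ext0 noethR cM) fM Hs.
  by apply: eq_st0 (Hn _ c cC Hc).
exists n, v; apply: eq_st0 (steq_pre inlp Hv) => x /=.
by rewrite /s /= linear0 addr0 linearZ.
Qed.

End Annihilation.

(** * Finite k-bases from nilpotence of the maximal ideal *)

Section FiniteDimension.
Variables (k : fieldType) (R : comAlgType k) (m : set R) (rho : {rmorphism R -> k}).
Hypotheses (m_ideal : is_ideal m) (m_complete : is_adically_complete m).
Hypotheses (rho_ker : forall x, rho x = 0 <-> m x) (rhoA : forall c, rho c%:A = c).
Hypothesis noethR : is_noetherian R.
Hypothesis finR : finite_representation_type R.
Implicit Types M N X Y H : lmodType R.

Lemma stable_nilpotent (r : R) M : cohen_macaulay M -> m r ->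
  exists n, st0 (fun x : M => r ^+ n *: x).
Proof.
move=> cM mr; have fM := cm_fg cM.
have [n [v Hv]] := power_factors noethR finR r cM; exists n.
have [b [p po]] := fg_coverS fM.
have [l Hl] := rV_lift (v \o p) po; have [A HA] := rV_mulmx l.
pose t : {linear M -> M} := idfun \- (r \*: v).
have : bijective t.
  apply: (bijective_of_residue m_ideal m_complete rho_ker rhoA (T := 1%:M - r *: A) po).
    move=> w; by rewrite mulmxBr mulmx1 linearB -scalemxAr [X in _ - X]linearZ /= -HA Hl.
  rewrite map_mxB map_mx1 map_mxZ (_ : rho r = 0) ?scale0r ?subr0 //.
  exact/rho_ker.
move=> /linear_bij_inv [t' [tt' t't]].
have : st0 (t' \o (fun x => r ^+ n *: t x)).
  apply: st0_comp; apply: eq_st0 Hv => x.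
  by rewrite /t /= scalerBr scalerA exprSr.
by apply: eq_st0 => x /=; rewrite linearZ /= tt'.
Qed.

(** The k-span of [s] plus [B], with k acting through R. Working modulo a submodule in this way
    avoids forming the quotient of Hom by the stably zero maps. *)
Fixpoint kspan (H : lmodType R) (B : set H) (s : seq H) (x : H) : Prop :=
  if s is y :: s' then exists c : k, kspan B s' (x - c%:A *: y) else B x.

Lemma kspan_base H (B : set H) s x y : submod B -> kspan B s x -> B y -> kspan B s (x + y).
Proof.
move=> [_ BD _]; elim: s x => [|z s IH] x /= Hx By; first exact: BD.
by have [c Hc] := Hx; exists c; rewrite addrAC; apply: IH.
Qed.

Lemma kspanD H (B : set H) s s' x y : submod B ->
  kspan B s x -> kspan B s' y -> kspan B (s ++ s') (x + y).
Proof.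
move=> sB; elim: s x => [|z s IH] x /= Hx Hy; first by rewrite addrC; apply: kspan_base.
by have [c Hc] := Hx; exists c; rewrite addrAC; apply: IH.
Qed.

Lemma kspanZ H (B : set H) s x a : submod B ->
  kspan B s x -> kspan B [seq a *: y | y <- s] (a *: x).
Proof.
move=> [_ _ BZ]; elim: s x => [|z s IH] x /= Hx; first exact: BZ.
have [c /IH Hc] := Hx; exists c.
by rewrite scalerA [_ * a]mulrC -scalerA -scalerBr.
Qed.

(* The submodule P + \sum_(r <- t) r H. *)
Fixpoint add_multiples (H : lmodType R) (P : set H) (t : seq R) : set H :=
  if t is r :: t' then fun x => exists y, add_multiples P t' (x - r *: y) else P.

Lemma add_multiples_submod H (P : set H) t : submod P -> submod (add_multiples P t).
Proof.
move=> sP; elim: t => //= r t [S0 SD SZ]; split=> [|x y [x' Hx] [y' Hy]|a x [x' Hx]].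
- by exists 0; rewrite scaler0 subr0.
- by exists (x' + y'); rewrite scalerDr opprD addrACA; apply: SD.
- by exists (a *: x'); rewrite scalerA mulrC -scalerA -scalerBr; apply: SZ.
Qed.

Lemma add_multiples_base H (P : set H) t x : P x -> add_multiples P t x.
Proof. by elim: t => //= r t IH Px; exists 0; rewrite scaler0 subr0; apply: IH. Qed.

Lemma add_multiples_mem H (P : set H) t r x : submod P -> r \in t ->
  add_multiples P t (r *: x).
Proof.
move=> sP; elim: t => //= r' t IH; rewrite inE => /orP [/eqP <-|/IH Hr].
  by exists x; rewrite subrr; case: (add_multiples_submod t sP).
by exists 0; rewrite scaler0 subr0.
Qed.

Lemma kspan_remainder H (P : set H) r t s x : kspan (add_multiples P (r :: t)) s x ->
  exists y, kspan (add_multiples P t) s (x - r *: y).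
Proof.
elim: s x => //= z s IH x [c /IH [y Hy]]; exists y, c.
by rewrite addrAC.
Qed.

(** The generators in [t] are removed one at a time. Substituting the decomposition of H into its
    own term r H replaces r H by r^n H, at the price of finitely many new k-generators, and r^n H
    lies in P for large n. *)
Lemma kspan_drop_multiples H (P : set H) t s : submod P ->
  (forall r, r \in t -> exists n, forall x, P (r ^+ n *: x)) ->
  (forall x, kspan (add_multiples P t) s x) -> exists s', forall x, kspan P s' x.
Proof.
move=> sP; elim: t s => [|r t IH] s nil Hs; first by exists s.
have [n Hn] := nil r (mem_head _ _).
have sB := add_multiples_submod t sP.
have [s' Hs'] : exists s', forall x, exists y, kspan (add_multiples P t) s' (x - r ^+ n *: y).
  elim: n {Hn} => [|n [s' Hs']].
    exists [::] => x; exists x; rewrite expr0 scale1r subrr; by case: sB.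
  exists (s' ++ [seq r ^+ n *: y | y <- s]) => x; have [y Hy] := Hs' x.
  have [z Hz] := kspan_remainder (Hs y); exists z.
  have := kspanD sB Hy (kspanZ (r ^+ n) sB Hz).
  by rewrite scalerBr scalerA -exprSr addrA subrK.
apply: (IH s') => [r' r't|x]; first by apply: nil; rewrite inE r't orbT.
have [y Hy] := Hs' x; rewrite -[x](subrK (r ^+ n *: y)).
by apply: kspan_base => //; apply: add_multiples_base.
Qed.

(** Since R = k + m, generators over R span over k modulo m H; the generators of m are then dropped
    by nilpotence. *)
Lemma kspan_exists H (P : set H) : finitely_generated H -> submod P ->
  (forall r, m r -> exists n, forall x, P (r ^+ n *: x)) -> exists s, forall x, kspan P s x.
Proof.
move=> /fg_lspan [s Hs] sP nil; have [n [g Hg]] := noethR m_ideal.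
pose t := [seq g i | i <- enum 'I_n].
have gm i : m (g i).
  apply/Hg; exists (fun j => (j == i)%:R).
  by rewrite (bigD1 i) //= eqxx mul1r big1 ?addr0 // => j /negbTE ->; rewrite mul0r.
have sB := add_multiples_submod t sP; have [S0 SD SZ] := sB.
have mB a x : m a -> add_multiples P t (a *: x).
  move=> /Hg [c ->]; rewrite scaler_suml; apply: submod_sum => // i.
  by rewrite -scalerA; apply: SZ; apply: add_multiples_mem => //; apply: map_f; rewrite mem_enum.
apply: (@kspan_drop_multiples H P t s sP) => [_ /mapP [i _ ->]|x]; first exact: nil.
move: (Hs x); elim: s x {Hs} => [|y s IH] x /=; first by move=> ->.
move=> [a /IH Ha]; exists (rho a); have ma : m (a - (rho a)%:A).
  by apply/rho_ker; rewrite rmorphB /= rhoA subrr.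
have := kspan_base sB Ha (mB _ y ma).
by rewrite scalerBl addrA subrK.
Qed.

Lemma kspan_nth H (P : set H) s x : kspan P s x ->
  exists c : 'I_(size s) -> k, P (x - \sum_i (c i)%:A *: s`_i).
Proof.
elim: s x => [|y s IH] x /=; first by exists (fun=> 0); rewrite big_ord0 subr0.
move=> [a /IH [c Hc]]; exists (fun i => if unlift ord0 i is Some j then c j else a).
rewrite big_ord_recl unlift_none /= opprD addrA.
by under eq_bigr do rewrite liftK.
Qed.

Definition spans H (P : set H) n (e : 'I_n -> H) : Prop :=
  forall x, exists c : 'I_n -> k, P (x - \sum_i (c i)%:A *: e i).

Lemma minimal_spans_basis H (P : set H) n (e : 'I_n -> H) : submod P -> spans P e ->
  (forall n' (e' : 'I_n' -> H), spans P e' -> (n <= n')%N) ->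
  forall c c' : 'I_n -> k, P (\sum_i (c i)%:A *: e i - \sum_i (c' i)%:A *: e i) -> c =1 c'.
Proof.
move=> sP He Hmin c c' Hcc j; apply/eqP/negPn/negP => ncj.
case: n e He Hmin c c' Hcc j ncj => [? ? ? ? ? ? []//|n] e He Hmin c c' Hcc j ncj.
have [P0 PD PZ] := sP.
suff /Hmin : spans P (fun i => e (lift j i)) by rewrite ltnn.
pose d i := c i - c' i; have dj : d j != 0 by rewrite subr_eq0.
have {}Hcc : P (\sum_i (d i)%:A *: e i).
  rewrite (_ : \sum_i _ = \sum_i (c i)%:A *: e i - \sum_i (c' i)%:A *: e i) //.
  by rewrite -sumrB; apply: eq_bigr => i _; rewrite /d scalerBl [LHS]scalerBl.
move=> x; have [b Hb] := He x.
(* Combining the expansion of x with [beta] times the relation cancels [e j], so the remaining n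
   vectors would span. *)
pose beta := b j / d j.
exists (fun i => b (lift j i) - beta * d (lift j i)).
have -> : \sum_i (b (lift j i) - beta * d (lift j i))%:A *: e (lift j i) =
    \sum_i (b (lift j i))%:A *: e (lift j i)
    - beta%:A *: \sum_i (d (lift j i))%:A *: e (lift j i).
  rewrite scaler_sumr -sumrB; apply: eq_bigr => i _.
  by rewrite scalerBl [LHS]scalerBl scalerA -[_%:A * _%:A](rmorphM (in_alg R)).
have := PD _ _ Hb (PZ beta%:A _ Hcc).
have split_j (a : 'I_n.+1 -> k) : \sum_i (a i)%:A *: e i =
    (a j)%:A *: e j + \sum_i (a (lift j i))%:A *: e (lift j i).
  by rewrite (bigD1_ord j).
rewrite (split_j b) (split_j d) scalerDr scalerA.
rewrite -[beta%:A * (d j)%:A](rmorphM (in_alg R)) /= mulfVK //.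
have cancel_u u w z : x - (u + w) + (u + z) = x - (w - z).
  by rewrite addrAC -addrA opprD addrACA subrr add0r opprB.
by rewrite cancel_u.
Qed.

Lemma has_stable_hom_dim_exists X M : cohen_macaulay X -> cohen_macaulay M ->
  exists n, has_stable_hom_dim X M n.
Proof.
move=> cX cM; have fM := cm_fg cM; have sP := submod_st0 X fM.
pose P := fun f : homm X M => st0 (hlin f).
have [|s Hs] := kspan_exists (fg_hom noethR (cm_fg cX) fM) sP.
  move=> r /(stable_nilpotent cM) [n Hn]; exists n => f.
  by apply: eq_st0 (st0_pre (hlin f) Hn) => x; rewrite hlinZ.
have ex : exists n, `[< exists e : 'I_n -> homm X M, spans P e >].
  by exists (size s); apply/asboolP; exists (fun i => s`_i) => x; exact: kspan_nth.
(* A spanning family of least length has unique coefficients, as [stable_hom_basis] requires. *)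
case: (ex_minnP ex) => n /asboolP [e He] Hmin; exists n, (fun i => hlin (e i)) => f.
have combE (c : 'I_n -> k) x :
    hlin (\sum_i (c i)%:A *: e i) x = \sum_i (c i)%:A *: hlin (e i) x.
  by rewrite hlin_sum; apply: eq_bigr => i _; rewrite hlinZ.
have [c Hc] := He (homm_of f); exists (\row_i c i); split=> [|c' Hc'].
  apply: eq_st0 Hc => x; rewrite hlinB homm_ofE combE; congr (_ - _).
  by apply: eq_bigr => i _; rewrite mxE.
have min n' (e' : 'I_n' -> homm X M) : spans P e' -> (n <= n')%N.
  by move=> H; apply: Hmin; apply/asboolP; exists e'.
apply/rowP => j; rewrite mxE.
apply: (minimal_spans_basis sP He min (c := c) (c' := fun i => c' 0 i)).
have [_ PD PZ] := sP.
have {}Hc' : P (homm_of f - \sum_i (c' 0 i)%:A *: e i).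
  by apply: eq_st0 Hc' => x; rewrite hlinB homm_ofE combE.
have := submodB sP Hc' Hc.
by rewrite opprB addrC subrKA.
Qed.

End FiniteDimension.

(** * Ranks and triangles *)

Section Triangle.
Variable R : comNzRingType.
Hypothesis noethR : is_noetherian R.
Implicit Types A B C M N S U V X Y Z OY OZ : lmodType R.

Definition stable_exact_at M X Y Z (phi : {linear Y -> Z}) (psi : {linear X -> Y}) : Prop :=
  forall u : {linear Y -> M}, st0 (u \o psi) <->
    exists v : {linear Z -> M}, stable_eq u (v \o phi).

Definition stable_pre_onto M Y Z (phi : {linear Y -> Z}) : Prop :=
  forall u : {linear Y -> M}, exists v : {linear Z -> M}, stable_eq u (v \o phi).

(* C is the cocone of f, and OY, OZ are syzygies of Y, Z; the stable category
   identifies OY -> OZ -> C -> Y -> Z with a part of the triangle on f. *)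
Lemma triangle_exists Y Z (f : {linear Y -> Z}) :
  cohen_macaulay Y -> cohen_macaulay Z ->
  exists C OY OZ (j : {linear C -> Y}) (d : {linear OZ -> C}) (g : {linear OY -> OZ}),
  [/\ [/\ cohen_macaulay C, cohen_macaulay OY & cohen_macaulay OZ],
      forall M, finitely_generated M ->
        [/\ stable_exact_at M f j, stable_exact_at M j d & stable_exact_at M d g]
    & forall M, finitely_generated M -> stable_iso_shift M ->
        stable_pre_onto M f -> stable_pre_onto M g].
Proof.
move=> cY cZ; have fY := cm_fg cY; have fZ := cm_fg cZ.
have [a [qY qYo]] := (fg_cover Y).1 fY; have [b [qZ qZo]] := (fg_cover Z).1 fZ.
have sY := short_exact_ker qYo; have sZ := short_exact_ker qZo.
have [l Hl] := rV_lift (f \o qY) qZo.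
(* Stably this is f, but it is onto, so its kernel is a Cohen-Macaulay model of the cocone. *)
pose s : {linear (Y * 'rV[R]_b)%type -> Z} := (f \o fst) \+ (qZ \o snd).
have sE y x : s (y, x) = f y + qZ x by [].
have sP z : s z = f z.1 + qZ z.2 by [].
have s0 x : s (0, x) = qZ x by rewrite sE linear0 add0r.
have so : onto s by move=> z; have [x <-] := qZo z; exists (0, x).
have sC := short_exact_ker so.
have cC : cohen_macaulay (kerm s).
  by apply: cm_kernel sC _ cZ => //; apply: cm_prod => //; exact: cm_rV.
pose j : {linear kerm s -> Y} := fst \o kerin s.
have [|d Hd] := corestr_inj (f := inrp \o kerin qZ) (@kerin_inj _ _ _ s).
  by move=> x; apply/kerinP; exact: etrans (s0 (kerin qZ x)) (kerinE x).
have [|g Hg] := corestr_inj (f := l \o kerin qY) (@kerin_inj _ _ _ qZ).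
  by move=> x; apply/kerinP; rewrite Hl /= kerinE linear0.
(* [e] is a null-homotopy: the composite of [g] and [d] is not zero but factors through the free
   cover of Y by - [e]. *)
have [|e He] := corestr_inj (f := (inlp \o qY) \- (inrp \o l)) (@kerin_inj _ _ _ s).
  by move=> x; apply/kerinP; rewrite sP /= subr0 sub0r linearN Hl /= subrr.
have dg x : d (g x) = - e (kerin qY x).
  apply: (@kerin_inj _ _ _ s); rewrite linearN Hd He.
  apply: injective_projections => /=; first by rewrite kerinE subr0 oppr0.
  by rewrite sub0r opprK; exact: Hg.
have jd x : j (d x) = 0 by rewrite /j /= Hd.
(* The same device one place further along: a free summand makes [d] surjective, and the kernel of
   the result is the syzygy of Y. *)
pose t : {linear (kerm qZ * 'rV[R]_a)%type -> kerm s} := (d \o fst) \+ (e \o snd).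
have tE x y : t (x, y) = d x + e y by [].
have tC x y : kerin s (t (x, y)) = (qY y, kerin qZ x - l y).
  by rewrite tE linearD Hd He; apply: injective_projections; rewrite /= ?subr0 ?add0r ?sub0r.
have gL : linear (fun x => (g x, kerin qY x)) by move=> c x y; rewrite !linearP.
have sT : short_exact (mklin gL) t.
  split=> [x y [_ /kerin_inj //]|c|[x y]].
    have := kerinE c.
    case E : (kerin s c) => [y z]; rewrite sE => Hyz.
    have [y' Hy'] := qYo y.
    have /kerinP [x Hx] : qZ (z + l y') = 0 by rewrite linearD Hl /= Hy' addrC.
    by exists (x, y'); apply: (@kerin_inj _ _ _ s); rewrite tC E Hy' -Hx addrK.
  split=> [H|[w [-> ->]]]; last by rewrite tE dg addNr.
  have := congr1 (kerin s) H; rewrite tC linear0 => -[/kerinP [w ->] H2].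
  exists w; congr pair; apply: (@kerin_inj _ _ _ qZ); rewrite Hg.
  by apply/eqP; rewrite -subr_eq0 H2.
have sD : short_exact d j.
  split=> [x y /(congr1 (kerin s))|y|x]; first by rewrite !Hd => -[/kerin_inj].
    have [x Hx] := qZo (- f y).
    have /kerinP [c Hc] : s (y, x) = 0 by rewrite sE Hx subrr.
    by exists c; rewrite /j /= -Hc.
  split=> [|[y ->]]; last exact: jd.
  move=> jx; have := kerinE x; have : (kerin s x).1 = 0 := jx.
  case E : (kerin s x) => [y z] y0; rewrite sE => H; rewrite /= in y0.
  have /kerinP [w Hw] : qZ z = 0 by rewrite -H y0 linear0 add0r.
  by exists w; apply: (@kerin_inj _ _ _ s); rewrite E Hd /= -Hw y0.
have eZ := cm_ext0 noethR cZ; have eY := cm_ext0 noethR cY; have eC := cm_ext0 noethR cC.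
exists (kerm s), (kerm qY), (kerm qZ), j, d, g; split.
- by split=> //; [exact: cm_syzygy sY cY|exact: cm_syzygy sZ cZ].
- move=> M fM; split=> u; split.
  + move=> Hu; have [|v Hv] := stable_exact (u := u \o fst) fZ eZ fM sC.
      exact: Hu.
    exists v; apply: eq_st0 (steq_pre inlp Hv) => y.
    have sy : s (y, 0) = f y by rewrite sE linear0 addr0.
    exact: (congr1 (fun z => u y - v z) sy).
  + move=> [v Hv]; apply: steq_st0 fM (steq_pre j Hv) _.
    apply: (@st0_rV _ _ _ b (\- (snd \o kerin s)) (v \o qZ)) => c /=.
    have e0 : f (kerin s c).1 = - qZ (kerin s c).2.
      by apply/eqP; rewrite -addr_eq0; apply/eqP; exact: (kerinE c).
    by rewrite e0 [qZ (- _)]linearN.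
  + by move=> Hu; exact: stable_exact fY eY fM sD Hu.
  + move=> [v Hv]; apply: steq_st0 fM (steq_pre d Hv) _.
    by apply: eq_st0 (st0_0 _ _) => x /=; rewrite -[v _]/(v (j (d x))) jd linear0.
  + move=> Hu; have [|v Hv] := stable_exact (u := u \o fst) (cm_fg cC) eC fM sT.
      exact: Hu.
    exists v; apply: eq_st0 (steq_pre inlp Hv) => y.
    have ty : t (y, 0) = d y by rewrite tE linear0 addr0.
    exact: (congr1 (fun z => u y - v z) ty).
  + move=> [v Hv]; apply: steq_st0 fM (steq_pre g Hv) _.
    apply: (@st0_rV _ _ _ a (kerin qY) (\- (v \o e))) => x /=.
    by rewrite dg linearN.
(* Transfer along Hom(OY, M) = Hom(OY, S) = Hom(Y, M) in the stable category, with S a syzygy of M.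
   A map u is moved into S by [tau], extended over the covers since Ext^1(Y, R) = 0, and descends to
   [g0] on Y. A stable factorization of [g0] through f then restricts to syzygies and returns by
   [sigma]. *)
- move=> M fM [S [[n [i [p [ii po ip]]]] [tau [sigma [st ts]]]]] Mf u.
  have fS : finitely_generated S by exact: fg_sub ii (fg_rV R n).
  have ipi x : p (i x) = 0 by apply/ip; exists x.
  have [L HL] := ext_lift_rV (i \o (tau \o u)) fY eY sY.
  have [|g0 Hg0] := factor_onto qYo (w := p \o L).
    by move=> x /kerinP [y ->]; rewrite /= HL /= ipi.
  have [v0 Hv0] := Mf g0; have [Lv HLv] := rV_lift (v0 \o qZ) po.
  have [|vS HvS] := corestr_inj (f := Lv \o kerin qZ) ii.
    by move=> x; apply/ip; rewrite /= HLv /= kerinE linear0.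
  have [w Hw] := st0_onto po Hv0.
  (* [D] takes values in S and is defined on the free cover of Y, so it witnesses that the two maps
     OY -> S agree stably. *)
  have [|D HD] := corestr_inj (f := L \- (Lv \o l) \- (w \o qY)) ii.
    move=> x; apply/ip; rewrite /= !linearB /= HLv /= Hl /= -Hw -[p (L x)]Hg0 /=.
    by rewrite subrr.
  exists (sigma \o vS).
  have H1 : stable_eq (tau \o u) (vS \o g).
    apply: (@st0_rV _ _ _ a (kerin qY) D) => x /=; apply: ii.
    rewrite linearB HvS HD /= Hg /=.
    rewrite HL kerinE (linear0 w); exact/esym/subr0.
  apply: (steq_trans fM (steq_sym (steq_pre u st))).
  exact: (steq_comp sigma H1).
Qed.

End Triangle.

(** * Ranks of precomposition maps *)

Section Coordinates.
Variables (k : fieldType) (R : comAlgType k).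
Implicit Types A B C M N X Y Z OY OZ : lmodType R.

(* Coordinates on the stable Hom space: a k-linear surjection from Hom(X, M)
   onto k^n whose kernel is P(X, M). *)
Definition coord X M n (co : {linear X -> M} -> 'rV[k]_n) : Prop :=
  [/\ forall (c : k) (f g h : {linear X -> M}),
        stable_eq h (fun x => c%:A *: f x + g x) -> co h = c *: co f + co g,
      forall f, co f = 0 <-> st0 f
    & forall v, exists f, co f = v].

Definition hom_dim X M n : Prop := exists co : {linear X -> M} -> 'rV[k]_n, coord co.

Lemma hom_dim_of_basis X M n : finitely_generated M ->
  has_stable_hom_dim X M n -> hom_dim X M n.
Proof.
move=> fM [e He].
pose comb (c : 'rV[k]_n) x := \sum_i ((c 0 i)%:A : R) *: e i x.
have combP c a b x : comb (c *: a + b) x = c%:A *: comb a x + comb b x.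
  rewrite scaler_sumr -big_split; apply: eq_bigr => i _ /=; rewrite !mxE.
  by rewrite scalerDl [LHS]scalerDl scalerA -[_%:A * _%:A](rmorphM (in_alg R)).
have comb0 x : comb 0 x = 0.
  by apply: big1 => i _; rewrite mxE !scale0r.
have /choice [co Hco] (f : {linear X -> M}) : exists c, stable_eq f (comb c) /\
    forall c', stable_eq f (comb c') -> c = c'.
  by have [c [Hc Uc]] := He f; exists c.
exists co; split.
- move=> c f g h Hh; apply: (Hco h).2; apply: (steq_trans fM Hh).
  rewrite (_ : comb _ = fun x => c%:A *: comb (co f) x + comb (co g) x); last first.
    by apply/funext => x; rewrite combP.
  apply: (steq_add fM _ (Hco g).1).
  by have := st0_scale c%:A (Hco f).1; apply: eq_st0 => x; rewrite scalerBr.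
- move=> f; split=> [H|Hf].
    by have := (Hco f).1; rewrite H; apply: eq_st0 => x; rewrite comb0 subr0.
  apply: (Hco f).2; apply: eq_st0 Hf => x; by rewrite comb0 subr0.
- move=> v; exists (hlin (\sum_i (v 0 i)%:A *: homm_of (e i))).
  apply: (Hco _).2; apply: steq_eq => x; rewrite hlin_sum; apply: eq_bigr => i _.
  by rewrite hlinZ homm_ofE.
Qed.

Lemma coord_eq X M n (co : {linear X -> M} -> 'rV[k]_n) (f g : {linear X -> M}) : coord co ->
  co f = co g <-> stable_eq f g.
Proof.
move=> [colin co0 _].
have E : co (f \- g) = (-1) *: co g + co f.
  by apply: colin; apply: steq_eq => x; rewrite /= scaleN1r scaleNr scale1r addrC.
split=> [H|H].
  by apply/(co0 (f \- g)); rewrite E H scaleN1r addNr.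
have : co (f \- g) = 0 by apply/co0.
by rewrite E scaleN1r addrC => /eqP; rewrite subr_eq0 => /eqP.
Qed.

Lemma coord_pre X Y M m n (coX : {linear X -> M} -> 'rV[k]_m)
    (coY : {linear Y -> M} -> 'rV[k]_n) (phi : {linear Y -> X}) :
  finitely_generated M -> coord coX -> coord coY ->
  exists A : 'M[k]_(m, n), forall u : {linear X -> M}, coY (u \o phi) = coX u *m A.
Proof.
move=> fM cX cY; have [Xlin X0 /choice [s Hs]] := cX; have [Ylin Y0 _] := cY.
have L : linear (fun v => coY (s v \o phi)).
  move=> c v w; apply: Ylin.
  apply: (steq_pre (f := s _) phi (g := fun x => c%:A *: s v x + s w x)).
  have -> : (fun x => c%:A *: s v x + s w x) = hlin (c%:A *: homm_of (s v) + homm_of (s w)).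
    by apply/funext => x; rewrite hlinD hlinZ !homm_ofE.
  apply/(coord_eq _ _ cX); rewrite Hs -{1}(Hs v) -{1}(Hs w); apply/esym/Xlin.
  by apply: steq_eq => x; rewrite hlinD hlinZ !homm_ofE.
have [A HA] := rV_mulmx (mklin L); exists A => u.
rewrite -HA; apply/(coord_eq _ _ cY); apply: steq_pre.
by apply/(coord_eq _ _ cX); rewrite Hs.
Qed.

Lemma hom_dim_uniq X M m n : finitely_generated M ->
  hom_dim X M m -> hom_dim X M n -> m = n.
Proof.
move=> fM; suff le a b : hom_dim X M a -> hom_dim X M b -> (a <= b)%N.
  by move=> Hm Hn; apply/eqP; rewrite eqn_leq !le.
move=> [co cco] [co' cco'].
have [A HA] := coord_pre idfun fM cco cco'; have [B HB] := coord_pre idfun fM cco' cco.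
apply: (@mulmx1_min _ _ _ A B).
apply/row_matrixP => i; rewrite !rowE mulmx1 mulmxA.
have [_ _ /(_ (delta_mx 0 i)) [f <-]] := cco.
rewrite -HA -HB; apply/(coord_eq _ _ cco); exact: steq_eq.
Qed.

Lemma hom_dim_prod X A B a b : finitely_generated A -> finitely_generated B ->
  hom_dim X A a -> hom_dim X B b -> hom_dim X (A * B)%type (a + b).
Proof.
move=> fA fB [coA cA] [coB cB]; have [Alin A0 Ao] := cA; have [Blin B0 Bo] := cB.
exists (fun f : {linear X -> (A * B)%type} => row_mx (coA (fst \o f)) (coB (snd \o f))); split.
- move=> c f g h H; rewrite scale_row_mx add_row_mx; congr row_mx.
    apply: Alin; exact: (steq_comp fst H).
  apply: Blin; exact: (steq_comp snd H).
- move=> f; split=> [H|Hf].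
    have /eq_row_mx [/A0 H1 /B0 H2] : row_mx (coA (fst \o f)) (coB (snd \o f)) = row_mx 0 0.
      by rewrite H row_mx0.
    have := st0_add (fg_prod fA fB) (st0_comp inlp H1) (st0_comp inrp H2).
    by apply: eq_st0 => x; rewrite [RHS]prod_split.
  rewrite (A0 (fst \o f)).2 ?(B0 (snd \o f)).2 ?row_mx0 //.
    exact: (st0_comp snd Hf).
  exact: (st0_comp fst Hf).
- move=> v; have [f Hf] := Ao (lsubmx v); have [g Hg] := Bo (rsubmx v).
  exists ((inlp \o f) \+ (inrp \o g)); rewrite -[RHS]hsubmxK -Hf -Hg; congr row_mx.
    by apply/(coord_eq _ _ cA); apply: steq_eq => x; rewrite /= addr0.
  by apply/(coord_eq _ _ cB); apply: steq_eq => x; rewrite /= add0r.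
Qed.

Lemma hom_dim_iso X M N n : finitely_generated M -> finitely_generated N ->
  stable_iso M N -> hom_dim X M n -> hom_dim X N n.
Proof.
move=> fM fN [f [g [gf fg]]] [co cco]; have [colin co0 coo] := cco.
exists (fun u : {linear X -> N} => co (g \o u)); split.
- move=> c u v h H; apply: colin; apply: (steq_trans fM (steq_comp g H)).
  by apply: steq_eq => x; rewrite /= linearD linearZ.
- move=> u; split=> [/co0 H|Hu]; last exact/co0/(st0_comp g Hu).
  apply: steq_st0 fN _ (st0_comp f H); apply: steq_sym; exact: (steq_pre u fg).
- move=> v; have [u Hu] := coo v; exists (f \o u); rewrite -Hu.
  apply/(coord_eq _ _ cco); exact: (steq_pre u gf).
Qed.

(** Matrices act on row vectors from the right, so exactness identifies the row space of [A] with
    the kernel of [B]. *)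
Lemma rank_exact M X Y Z x y z (phi : {linear Y -> Z}) (psi : {linear X -> Y})
    (coX : {linear X -> M} -> 'rV[k]_x) (coY : {linear Y -> M} -> 'rV[k]_y)
    (coZ : {linear Z -> M} -> 'rV[k]_z) (A : 'M[k]_(z, y)) (B : 'M[k]_(y, x)) :
  coord coX -> coord coY -> coord coZ ->
  (forall u : {linear Z -> M}, coY (u \o phi) = coZ u *m A) ->
  (forall u : {linear Y -> M}, coX (u \o psi) = coY u *m B) ->
  stable_exact_at M phi psi -> (\rank A + \rank B = y)%N.
Proof.
move=> cX cY cZ HA HB ex; have [_ _ Yo] := cY; have [_ _ Zo] := cZ.
have [_ X0 _] := cX.
suff -> : \rank A = \rank (kermx B) by rewrite mxrank_ker subnK // rank_leq_row.
suff [s1 s2] : (A <= kermx B)%MS /\ (kermx B <= A)%MS.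
  by apply/eqP; rewrite eqn_leq !mxrankS.
split.
  apply/sub_kermxP; apply/row_matrixP => i; rewrite row0 rowE mulmxA.
  have [v <-] := Zo (delta_mx 0 i); rewrite -HA -HB.
  apply/X0/ex; exists v; exact: steq_refl.
apply/row_subP => i; have [u Hu] := Yo (row i (kermx B)).
have /X0 /ex [v Hv] : coX (u \o psi) = 0.
  by rewrite HB Hu -row_mul mulmx_ker row0.
have e : coY u = coY (v \o phi) by apply/(coord_eq _ _ cY).
by rewrite -Hu e HA submxMl.
Qed.

Lemma rank_onto M Y Z y z (phi : {linear Y -> Z}) (coY : {linear Y -> M} -> 'rV[k]_y)
    (coZ : {linear Z -> M} -> 'rV[k]_z) (A : 'M[k]_(z, y)) :
  coord coY -> coord coZ -> (forall u : {linear Z -> M}, coY (u \o phi) = coZ u *m A) ->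
  (\rank A = y <-> stable_pre_onto M phi).
Proof.
move=> cY cZ HA; have [_ _ Yo] := cY; have [_ _ Zo] := cZ; split=> [rA u|H].
  have /submxP [w Hw] : (coY u <= A)%MS by apply: submx_full; rewrite /row_full rA.
  have [v Hv] := Zo w; exists v; apply/(coord_eq _ _ cY).
  by rewrite Hw -Hv -HA.
apply/eqP; rewrite -[_ == _]/(row_full A) -sub1mx; apply/row_subP => i.
have [u Hu] := Yo (row i 1%:M); have [v Hv] := H u.
have e : coY u = coY (v \o phi) by apply/(coord_eq _ _ cY).
by rewrite -Hu e HA submxMl.
Qed.

(* With exactness at Y, C and OZ, the rank of precomposition with f plus that of
   precomposition with g only depends on the dimensions, so surjectivity of both
   is detected by the dimensions alone. *)
Lemma pre_onto_transfer M N Y Z C OY OZ (f : {linear Y -> Z}) (j : {linear C -> Y})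
    (d : {linear OZ -> C}) (g : {linear OY -> OZ}) :
  finitely_generated M -> finitely_generated N ->
  (forall L : lmodType R, finitely_generated L -> [/\ stable_exact_at L f j,
     stable_exact_at L j d & stable_exact_at L d g]) ->
  (exists n, hom_dim Y M n /\ hom_dim Y N n) ->
  (exists n, hom_dim C M n /\ hom_dim C N n) ->
  (exists n, hom_dim OZ M n /\ hom_dim OZ N n) ->
  (exists n, hom_dim OY M n /\ hom_dim OY N n) ->
  (exists n, hom_dim Z M n /\ hom_dim Z N n) ->
  stable_pre_onto M f -> stable_pre_onto M g -> stable_pre_onto N f.
Proof.
move=> fM fN ex [y [yM yN]] [c [cM cN]] [oz [ozM ozN]] [oy [oyM oyN]] [z [zM zN]] Mf Mg.
have count L : finitely_generated L -> hom_dim Y L y -> hom_dim C L c ->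
    hom_dim OZ L oz -> hom_dim OY L oy -> hom_dim Z L z ->
    exists a b : nat, [/\ (a <= y)%N, (b <= oy)%N, (a + b + c = y + oz)%N,
      a = y <-> stable_pre_onto L f & b = oy <-> stable_pre_onto L g].
  move=> fL [coY cY] [coC cC] [coOZ cOZ] [coOY cOY] [coZ cZ].
  have [A HA] := coord_pre f fL cZ cY; have [B HB] := coord_pre j fL cY cC.
  have [D HD] := coord_pre d fL cC cOZ; have [G HG] := coord_pre g fL cOZ cOY.
  have [e1 e2 e3] := ex L fL.
  have r1 := rank_exact cC cY cZ HA HB e1.
  have r2 := rank_exact cOZ cC cY HB HD e2.
  have r3 := rank_exact cOY cOZ cC HD HG e3.
  exists (\rank A), (\rank G); split.
  - exact: rank_leq_col.
  - exact: rank_leq_col.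
  - by move: r1 r2 r3; clear; lia.
  - exact: rank_onto HA.
  - exact: rank_onto HG.
have [a [b [ay boy e Ha Hb]]] := count M fM yM cM ozM oyM zM.
have [a' [b' [ay' boy' e' Ha' Hb']]] := count N fN yN cN ozN oyN zN.
(* For M both ranks attain their bounds y and oy. For N the sum is the same and the bounds are the
   same, so neither rank can be smaller. *)
apply/Ha'; move: (Ha.2 Mf) (Hb.2 Mg) ay' boy' e e'; clear; lia.
Qed.

End Coordinates.

(** * Cancellation *)

Section Retracts.
Variable R : comNzRingType.
Hypothesis noethR : is_noetherian R.
Implicit Types A B C M N S U V X Y Z : lmodType R.

Lemma stable_iso_refl M : stable_iso M M.
Proof. by exists idfun, idfun; split; exact: steq_refl. Qed.

Lemma stable_iso_sym M N : stable_iso M N -> stable_iso N M.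
Proof. by move=> [f [g [H1 H2]]]; exists g, f. Qed.

Lemma stable_iso_trans M N A : finitely_generated M -> finitely_generated A ->
  stable_iso M N -> stable_iso N A -> stable_iso M A.
Proof.
move=> fM fA [f [g [gf fg]]] [f' [g' [gf' fg']]].
exists (f' \o f), (g \o g'); split.
  apply: (steq_trans fM _ gf); exact: (steq_comp g (steq_pre f gf')).
apply: (steq_trans fA _ fg'); exact: (steq_comp f' (steq_pre g' fg)).
Qed.

Lemma module_iso_stable_iso M N : module_iso M N -> stable_iso M N.
Proof.
move=> /module_isoP [f [g [fg gf]]]; exists f, g.
by split; apply: steq_eq => x /=; rewrite ?fg ?gf.
Qed.

Lemma stable_iso_prod M N A B : finitely_generated M -> finitely_generated N ->
  finitely_generated A -> finitely_generated B ->
  stable_iso M N -> stable_iso A B -> stable_iso (M * A)%type (N * B)%type.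
Proof.
move=> fM fN fA fB [f [f' [f1 f2]]] [g [g' [g1 g2]]].
exists ((inlp \o (f \o fst)) \+ (inrp \o (g \o snd))),
  ((inlp \o (f' \o fst)) \+ (inrp \o (g' \o snd))); split.
  have := st0_add (fg_prod fM fA) (st0_comp inlp (st0_pre fst f1)) (st0_comp inrp (st0_pre snd g1)).
  apply: eq_st0 => -[x y]; apply: injective_projections => /=.
    by rewrite !addr0.
  by rewrite !add0r.
have := st0_add (fg_prod fN fB) (st0_comp inlp (st0_pre fst f2)) (st0_comp inrp (st0_pre snd g2)).
apply: eq_st0 => -[x y]; apply: injective_projections => /=.
  by rewrite !addr0.
by rewrite !add0r.
Qed.

Lemma stable_iso_prod0l U A : finitely_generated U -> finitely_generated A ->
  st0 (@idfun U) -> stable_iso (U * A)%type A.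
Proof.
move=> fU fA U0; exists snd, inrp; split; last by apply: steq_eq.
apply: steq_sym; apply: eq_st0 (st0_comp inlp (st0_pre fst U0)) => -[x y] /=.
by apply: injective_projections; rewrite /= ?subr0 ?subrr.
Qed.

Lemma stable_retract_trans M N A : finitely_generated M ->
  stable_retract M N -> stable_retract N A -> stable_retract M A.
Proof.
move=> fM [f [g gf]] [f' [g' gf']]; exists (f' \o f), (g \o g').
apply: (steq_trans fM _ gf); exact: (steq_comp g (steq_pre f gf')).
Qed.

Definition local_end U : Prop :=
  forall f : {linear U -> U}, bijective f \/ bijective (fun x => x - f x).

(** The components x and y of g f through [A] and [B] add up to the identity only stably, while
    locality concerns genuine endomorphisms. The dichotomy is therefore applied to x alone, and y is
    compared stably with 1 - x. *)
Lemma retract_prod U A B : finitely_generated U -> local_end U ->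
  stable_retract U (A * B)%type -> stable_retract U A \/ stable_retract U B.
Proof.
move=> fU locU [f [g gf]].
pose x : {linear U -> U} := (g \o inlp) \o (fst \o f).
pose y : {linear U -> U} := (g \o inrp) \o (snd \o f).
have xy u : x u + y u = g (f u) by rewrite /x /y /= -linearD -prod_split.
have [bx|b1x] := locU x.
  left; have [t [xt tx]] := linear_bij_inv bx.
  exists (fst \o f), (t \o (g \o inlp)); apply: steq_eq => u; exact: xt.
right; pose x' : {linear U -> U} := idfun \- x.
have [t [xt tx]] := @linear_bij_inv _ _ _ x' b1x.
exists (snd \o f), (t \o (g \o inrp)).
have : stable_eq y x'.
  apply: eq_st0 gf => u; rewrite -[LHS]/(g (f u) - u) -[RHS]/(y u - (u - x u)) -xy.
  by rewrite opprB addrA [y u + _]addrC.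
move=> /(steq_comp t) H; apply: (steq_trans fU H); apply: steq_eq => u; exact: xt.
Qed.

(** The composite f g is stably idempotent. If it is bijective, cancelling it makes it stably the
    identity; if 1 - f g is bijective, then (1 - f g) f is stably zero, so f and hence the identity
    of [U] are stably zero. *)
Lemma retract_stable_iso U V : finitely_generated U -> finitely_generated V ->
  local_end V -> ~ st0 (@idfun U) -> stable_retract U V -> stable_iso U V.
Proof.
move=> fU fV locV nU [f [g gf]].
have [be|be] := locV (f \o g).
  have [t [et te]] := linear_bij_inv be.
  exists f, g; split=> //.
  have Hg : stable_eq g (g \o t).
    apply: (@steq_trans _ _ _ _ ((g \o f) \o (g \o t))) fU _ _.
      by apply: steq_eq => v /=; have := te v => /= ->.
    exact: (steq_pre (g \o t) gf).
  apply: (steq_trans fV (steq_comp f Hg)); apply: steq_eq => v; exact: te.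
pose e' : {linear V -> V} := idfun \- (f \o g).
have [t [et te]] := @linear_bij_inv _ _ _ e' be.
case: nU; have Hf : st0 f.
  have : st0 (t \o (e' \o f)).
    apply: st0_comp; apply: eq_st0 (st0_opp (steq_comp f gf)) => u.
    by rewrite /e' /= opprB.
  by apply: eq_st0 => u; rewrite /=; exact: et.
exact: steq_st0 fU (steq_sym gf) (st0_comp g Hf).
Qed.

(** [Z] is a power of [M], one factor for each map in [s]. The last clause keeps what is needed of
    this shape: a stably nonzero retract of Z with local endomorphisms is already a retract of one
    factor. *)
Lemma left_approximation N M (s : seq (homm N M)) : cohen_macaulay M ->
  exists Z (f : {linear N -> Z}), [/\ cohen_macaulay Z,
    forall u, lspan s u -> exists v : {linear Z -> M}, forall x, hlin u x = v (f x)
  & forall U, finitely_generated U -> local_end U -> ~ st0 (@idfun U) ->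
      stable_retract U Z -> stable_retract U M].
Proof.
move=> cM; elim: s => [|h s [Z [f [cZ Hf HZ]]]].
  exists ('rV[R]_0 : lmodType R), \0; split; first exact: cm_rV.
    by move=> u /= ->; exists \0 => x; rewrite hlin0.
  move=> U fU _ nU [a [b ab]]; case: nU.
  apply: steq_st0 fU (steq_sym ab) _; apply: eq_st0 (st0_0 U U) => x /=.
  by rewrite (_ : a x = 0) ?linear0 //; apply/rowP; case.
exists (M * Z)%type, ((inlp \o hlin h) \+ (inrp \o f)); split; first exact: cm_prod.
  move=> u /= [c /Hf [v Hv]]; exists ((c \*: fst) \+ (v \o snd)) => x.
  by rewrite /= addr0 add0r -Hv hlinB hlinZ addrC subrK.
move=> U fU locU nU UZ.
by have [//|] := retract_prod fU locU UZ; exact: HZ.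
Qed.

(** The hypothesis on syzygies concerns indecomposables; this carries it to their finite sums. *)
Lemma syzygy_shift_prod M N : finitely_generated M -> finitely_generated N ->
  stable_iso_shift M -> stable_iso_shift N -> stable_iso_shift (M * N)%type.
Proof.
move=> fM fN [S [[a [i [p Hi]]] MS]] [T [[b [j [q Hj]]] NT]].
have [k [r [Hk _]]] := short_exact_prod Hi Hj.
exists (S * T)%type; split; first by exists (a + b)%N, k, r.
by apply: stable_iso_prod => //; [exact: fg_syzygy Hi|exact: fg_syzygy Hj].
Qed.

Lemma syzygy_shift_rV0 : @stable_iso_shift R 'rV[R]_0.
Proof.
exists 'rV[R]_0; split; last exact: stable_iso_refl.
have r0 (x y : 'rV[R]_0) : x = y by apply/rowP; case.
exists 0%N, idfun, \0; split=> [x y _|y|x]; [exact: r0|by exists y; exact: r0|].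
by split=> // _; exists x.
Qed.

Lemma cmsum_shift l : (forall U : cmType R, indecomposable U -> @stable_iso_shift R U) ->
  all_indec l -> @stable_iso_shift R (cmsum l).
Proof.
move=> sh; elim: l => [_|U l IH [HU Hl]] /=; first exact: syzygy_shift_rV0.
apply: syzygy_shift_prod; [exact: cm_fg (cmP U)| |exact: sh|exact: IH].
exact: cm_fg (cmsum_cm noethR l).
Qed.

Lemma retract_cmsum U l : finitely_generated U -> local_end U -> ~ st0 (@idfun U) ->
  all_indec l -> stable_retract U (cmsum l) ->
  exists (V : cmType R) l', [/\ indecomposable V, all_indec l',
    module_iso (cmsum l) (V * cmsum l')%type & stable_retract U V].
Proof.
move=> fU locU nU; elim: l => [_ [a [b ab]]|V l IH [HV Hl]] /=.
  case: nU; apply: steq_st0 fU (steq_sym ab) _; apply: eq_st0 (st0_0 U U) => x /=.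
  by rewrite (_ : a x = 0) ?linear0 //; apply/rowP; case.
move=> /(retract_prod fU locU) [UV|/(IH Hl) [W [l' [HW Hl' i UW]]]].
  by exists V, l; split=> //; exact: module_iso_refl.
exists W, (V :: l'); split=> //=.
apply: module_iso_trans (module_iso_prod (module_iso_refl _) i) _.
exact: module_iso_prodCA.
Qed.

End Retracts.

(** * Modules with equal stable Hom dimensions *)

Section SameDimensions.
Variables (k : fieldType) (R : comAlgType k).
Hypothesis noethR : is_noetherian R.
Hypothesis fin_dim : forall X M : lmodType R, cohen_macaulay X -> cohen_macaulay M ->
  exists n, has_stable_hom_dim X M n.
Hypothesis indec_local : forall U : cmType R, indecomposable U -> local_end U.
Hypothesis shiftR : forall U : cmType R, indecomposable U -> stable_iso_shift U.
Implicit Types A B M N U V X Y Z : lmodType R.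

Definition same_dims M N : Prop := forall X, cohen_macaulay X ->
  exists n, hom_dim X M n /\ hom_dim X N n.

Lemma same_dims_iso M N : cohen_macaulay M -> cohen_macaulay N -> stable_iso M N ->
  same_dims M N.
Proof.
move=> cM cN MN X cX; have [n Hn] := fin_dim cX cM; exists n.
have H := hom_dim_of_basis (cm_fg cM) Hn; split=> //.
exact: hom_dim_iso (cm_fg cM) (cm_fg cN) MN H.
Qed.

Lemma same_dims_sym M N : same_dims M N -> same_dims N M.
Proof. by move=> H X /H [n [? ?]]; exists n. Qed.

Lemma same_dims_trans M N A : finitely_generated N ->
  same_dims M N -> same_dims N A -> same_dims M A.
Proof.
move=> fN H H' X cX; have [n [HM HN]] := H X cX; have [n' [HN' HA]] := H' X cX.
by exists n; split=> //; rewrite (hom_dim_uniq fN HN HN').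
Qed.

Lemma same_dims_cancel U A B : cohen_macaulay U -> cohen_macaulay A -> cohen_macaulay B ->
  same_dims (U * A)%type (U * B)%type -> same_dims A B.
Proof.
move=> cU cA cB H X cX; have [n [HA HB]] := H X cX.
have fU := cm_fg cU; have fA := cm_fg cA; have fB := cm_fg cB.
have [u /(hom_dim_of_basis fU) Hu] := fin_dim cX cU.
have [a /(hom_dim_of_basis fA) Ha] := fin_dim cX cA.
have [b /(hom_dim_of_basis fB) Hb] := fin_dim cX cB.
have ea := hom_dim_uniq (fg_prod fU fA) (hom_dim_prod fU fA Hu Ha) HA.
have eb := hom_dim_uniq (fg_prod fU fB) (hom_dim_prod fU fB Hu Hb) HB.
by exists a; split=> //; rewrite (_ : a = b) //; apply/eqP; rewrite -(eqn_add2l u) ea eb.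
Qed.

Lemma retract_of_same_dims M N : cohen_macaulay M -> cohen_macaulay N ->
  stable_iso_shift M -> same_dims M N ->
  forall U, finitely_generated U -> local_end U -> ~ st0 (@idfun U) ->
    stable_retract U N -> stable_retract U M.
Proof.
move=> cM cN shM MN; have fM := cm_fg cM; have fN := cm_fg cN.
have [s Hs] := (fg_lspan _).1 (fg_hom noethR fN fM).
have [Z [f [cZ Hf HZ]]] := left_approximation noethR s cM.
have [C [OY [OZ [j [d [g [[cC cOY cOZ] ex sh]]]]]]] := triangle_exists noethR f cN cZ.
have Mf : stable_pre_onto M f.
  move=> u; have [v Hv] := Hf (homm_of u) (Hs _); exists v.
  by apply: steq_eq => x /=; rewrite -Hv homm_ofE.
have Nf := pre_onto_transfer fM fN ex (MN _ cN) (MN _ cC) (MN _ cOZ) (MN _ cOY) (MN _ cZ)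
  Mf (sh M fM shM Mf).
have [v Hv] := Nf idfun.
move=> U fU locU nU UN; apply: HZ => //.
apply: (stable_retract_trans fU UN); exists f, v; exact: steq_sym.
Qed.

(** Tested on M itself: both coordinate maps land in the same k^n, and the one for Hom(M, 0) is onto
    yet takes only the value 0. *)
Lemma st0_of_same_dims M : cohen_macaulay M -> same_dims M 'rV[R]_0 -> st0 (@idfun M).
Proof.
move=> cM /(_ M cM) [n [[co [_ co0 _]] [co' [_ co0' coo']]]].
apply/(co0 idfun); have [f <-] := coo' (co idfun); apply/co0'.
apply: eq_st0 (st0_0 _ _) => x; by apply/rowP; case.
Qed.

(** Induction on [l'] with [l] arbitrary: a summand U of the second sum is found stably among the
    summands of the first, is split off on both sides, and cancels from the dimensions by
    additivity. *)
Lemma cmsum_stable_iso l l' : all_indec l -> all_indec l' ->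
  same_dims (cmsum l) (cmsum l') -> stable_iso (cmsum l) (cmsum l').
Proof.
have cs := cmsum_cm noethR; have fs l0 := cm_fg (cs l0).
elim: l' l => [|U l' IH] l Hl /=.
  move=> _ /(st0_of_same_dims (cs l)) H0; exists \0, \0; split.
    by apply: steq_sym; apply: eq_st0 H0 => x; rewrite /= subr0.
  by apply: steq_eq => x; apply/rowP; case.
move=> [HU Hl'] H; have cU := cmP U; have fU := cm_fg cU.
have cN : cohen_macaulay (U * cmsum l')%type by exact: cm_prod.
(* Free summands are invisible stably and cannot be matched with a summand of [l]; they are
   discarded separately. *)
have [U0|nU] := pselect (st0 (@idfun U)).
  have iN := stable_iso_prod0l fU (fs l') U0.
  have H' := same_dims_trans (cm_fg cN) H (same_dims_iso cN (cs l') iN).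
  apply: stable_iso_trans (fs l) (cm_fg cN) (IH l Hl Hl' H') _; exact: stable_iso_sym.
have UM : stable_retract U (cmsum l).
  apply: (retract_of_same_dims (cs l) cN (cmsum_shift noethR shiftR Hl) H fU (indec_local HU) nU).
  by exists inlp, fst; exact: steq_eq.
have [V [r [HV Hr iM UV]]] := retract_cmsum fU (indec_local HU) nU Hl UM.
have cV := cmP V; have fV := cm_fg cV.
have cVr : cohen_macaulay (V * cmsum r)%type by exact: cm_prod.
have cUr : cohen_macaulay (U * cmsum r)%type by exact: cm_prod.
have UVi := retract_stable_iso fU fV (indec_local HV) nU UV.
have iM' : stable_iso (cmsum l) (U * cmsum r)%type.
  apply: stable_iso_trans (fs l) (cm_fg cUr) (module_iso_stable_iso iM) _.
  apply: stable_iso_prod => //; [exact: stable_iso_sym|exact: stable_iso_refl].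
have H1 : same_dims (U * cmsum r)%type (U * cmsum l')%type.
  apply: same_dims_trans (fs l) _ H; apply: same_dims_sym.
  exact: same_dims_iso (cs l) cUr iM'.
have H2 := IH r Hr Hl' (same_dims_cancel cU (cs r) (cs l') H1).
apply: stable_iso_trans (fs l) (cm_fg cN) iM' _.
by apply: stable_iso_prod => //; exact: stable_iso_refl.
Qed.

Lemma stable_iso_of_same_dims M N : cohen_macaulay M -> cohen_macaulay N ->
  same_dims M N -> stable_iso M N.
Proof.
move=> cM cN H.
have [l [Hl Ml]] := cm_decompose noethR cM; have [l' [Hl' Nl']] := cm_decompose noethR cN.
have cs := cmsum_cm noethR.
have sM := module_iso_stable_iso Ml; have sN := module_iso_stable_iso Nl'.
have H' : same_dims (cmsum l) (cmsum l').
  apply: (same_dims_trans (cm_fg cM)).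
    by apply: same_dims_sym; exact: same_dims_iso.
  by apply: (same_dims_trans (cm_fg cN) H); exact: same_dims_iso.
apply: (stable_iso_trans (cm_fg cM) (cm_fg cN) sM).
apply: (stable_iso_trans (cm_fg (cs l)) (cm_fg cN) (cmsum_stable_iso Hl Hl' H')).
exact: stable_iso_sym.
Qed.

Lemma has_stable_hom_dim_iso X M N n : finitely_generated M -> finitely_generated N ->
  stable_iso M N -> has_stable_hom_dim X M n -> has_stable_hom_dim X N n.
Proof.
move=> fM fN [f [g [gf fg]]] [e He]; exists (fun i => f \o e i) => u.
have sumE (h : {linear M -> N}) (c : 'rV[k]_n) x :
    h (\sum_i ((c 0 i)%:A : R) *: e i x) = \sum_i ((c 0 i)%:A : R) *: h (e i x).
  by rewrite linear_sum; apply: eq_bigr => i _; rewrite linearZ.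
have [c [Hc Uc]] := He (g \o u); exists c; split.
  apply: (steq_trans fN (steq_sym (steq_pre u fg))).
  apply: eq_st0 (steq_comp f Hc) => x /=; by rewrite sumE.
move=> c' Hc'; apply: Uc; apply: (steq_trans fM (steq_comp g Hc')).
pose w := hlin (\sum_i ((c' 0 i)%:A : R) *: homm_of (e i)).
have wE x : w x = \sum_i ((c' 0 i)%:A : R) *: e i x.
  by rewrite hlin_sum; apply: eq_bigr => i _; rewrite hlinZ homm_ofE.
by apply: eq_st0 (steq_pre w gf) => x /=; rewrite wE sumE.
Qed.

Lemma stable_hom_dim_iso X M N : finitely_generated M -> finitely_generated N ->
  stable_iso M N -> stable_hom_dim X M = stable_hom_dim X N.
Proof.
move=> fM fN MN; rewrite /stable_hom_dim.
(* [stable_hom_dim] picks a number satisfying a predicate, so equal predicates force the same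
   choice. *)
suff -> : has_stable_hom_dim X M = has_stable_hom_dim X N by [].
apply/funext => n; apply/propext.
split; apply: has_stable_hom_dim_iso => //; exact: stable_iso_sym.
Qed.

Lemma stable_hom_dim_eq (M N : cmType R) :
  (forall X : cmType R, stable_hom_dim X M = stable_hom_dim X N) -> same_dims M N.
Proof.
have dimE (X L : lmodType R) : cohen_macaulay X -> cohen_macaulay L ->
    exists2 n, stable_hom_dim X L = Some n & has_stable_hom_dim X L n.
  move=> cX cL; rewrite /stable_hom_dim; case: pselect => [h|[]]; last exact: fin_dim.
  by exists (projT1 (cid h)) => //; exact: (projT2 (cid h)).
move=> H X cX; have [n en Hn] := dimE X M cX (cmP M).
have [n' en' Hn'] := dimE X N cX (cmP N); exists n.
have := H (CMType cX); rewrite /= en en' => -[nn']; split.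
  exact: hom_dim_of_basis (cm_fg (cmP M)) Hn.
by rewrite nn'; exact: hom_dim_of_basis (cm_fg (cmP N)) Hn'.
Qed.

End SameDimensions.

Lemma dim_le_refl a : dim_le a a.
Proof. by case: a => //= n. Qed.

Lemma dim_le_trans a b c : dim_le a b -> dim_le b c -> dim_le a c.
Proof. by case: a b c => [a|] [b|] [c|] //=; exact: leq_trans. Qed.

Lemma dim_le_anti a b : dim_le a b -> dim_le b a -> a = b.
Proof.
by case: a b => [a|] [b|] //= ab ba; congr Some; apply/eqP; rewrite eqn_leq ab.
Qed.

Theorem corollary2p10 (k : closedFieldType) (hchar : [pchar k] =i pred0)
  (R : comAlgType k) (m : set R)
  (hloc : is_local_with m)
  (hcomplete : is_adically_complete m)
  (hgor : is_gorenstein R)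
  (hres : has_residue_field m)
  (hfin : finite_representation_type R)
  (hshift : forall U : cmType R, indecomposable U -> stable_iso_shift U) :
  (forall M N : cmType R,
     (forall X : cmType R, stable_hom_dim X M = stable_hom_dim X N)
       <-> stable_iso M N) /\
  partial_order_mod (fun M N : cmType R => stable_iso M N)
    (fun M N : cmType R => stable_hom_le M N).
Proof.
have [noethR _] := hgor; have [[m_ideal _ _] _] := hloc.
have [rho [rho_ker rhoA]] := residue_map m_ideal hres.
have fin_dim X M := has_stable_hom_dim_exists m_ideal hcomplete rho_ker rhoA noethR hfin
  (X := X) (M := M).
have loc (U : cmType R) : indecomposable U -> local_end U.
  move=> HU f; exact: (indecomposable_local m_ideal hcomplete rho_ker rhoA f (cm_fg (cmP U)) HU).
have fg (M : cmType R) : finitely_generated M := cm_fg (cmP M).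
have main (M N : cmType R) : (forall X : cmType R, stable_hom_dim X M = stable_hom_dim X N)
    <-> stable_iso M N.
  split=> [H|MN X]; last exact: stable_hom_dim_iso (fg M) (fg N) MN.
  apply: (stable_iso_of_same_dims noethR fin_dim loc hshift (cmP M) (cmP N)).
  exact: stable_hom_dim_eq.
split=> //; split.
- split=> [M|M N|M N L]; [exact: stable_iso_refl|exact: stable_iso_sym|].
  exact: stable_iso_trans (fg M) (fg L).
- by move=> M M' N N' /main MM' /main NN' H X; rewrite -MM' -NN'.
- by move=> M X; exact: dim_le_refl.
- by move=> M N MN NM; apply/main => X; apply: dim_le_anti.
- by move=> M N L MN NL X; exact: dim_le_trans (MN X) (NL X).
Qed.
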